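(* Suppose the following (Zhao's Integral Conjecture) holds: for every $n\ge 1$, every open subset $B$ of $\mathbb{R}^n$ and every positive measure $\sigma$ on $B$ such that $\int_B g\,d\sigma$ is finite for every $g\in\mathbb{C}[x]=\mathbb{C}[x_1,\ldots,x_n]$, the set $\{f\in\mathbb{C}[x] : \int_B f\,d\sigma=0\}$ is a Mathieu subspace of $\mathbb{C}[x]$. Then the Image Conjecture for classical orthogonal polynomials holds: for every $n\ge 1$ and every classical weight function $w$ on $B\subset\mathbb{R}^n$ (of Hermite, Laguerre or Jacobi type), with associated operators $\Lambda_i=w^{-1}\circ\partial_i\circ w=\partial_i+w^{-1}\partial_i(w)$, the subspace $\mathrm{Im}'\Lambda=\mathbb{C}[x]\cap\sum_{i=1}^n\Lambda_i(\mathbb{C}[x])$ is a Mathieu subspace of $\mathbb{C}[x]$.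
   Context: ''For almost all $m$'' means for all positive integers $m$ with only finitely many exceptions. A $\mathbb{C}$-linear subspace $M$ of a commutative $\mathbb{C}$-algebra $R$ is called a Mathieu subspace of $R$ if the following holds: whenever $f\in R$ satisfies $f^m\in M$ for all $m\ge 1$, then for every $g\in R$ one has $gf^m\in M$ for almost all $m$. Classical weight functions. In one variable these are: (1) Hermite: $B=\mathbb{R}$, $w(x)=e^{-x^2}$; (2) Laguerre: $B=(0,\infty)$, $w(x)=x^{\alpha}e^{-x}$ with $\alpha>-1$; (3) Jacobi: $B=(-1,1)$, $w(x)=(1-x)^{\alpha}(1+x)^{\beta}$ with $\alpha,\beta>-1$. In $n$ variables, a classical weight function of Hermite (respectively Laguerre, Jacobi) type is $w(x)=w_1(x_1)\cdots w_n(x_n)$ on $B=B_1\times\cdots\times B_n$, where each $(B_i,w_i)$ is a one-variable Hermite (respectively Laguerre, Jacobi) pair. Here $\partial_i=\partial/\partial x_i$, and $\Lambda_i$ sends a polynomial $f$ to the function $\partial_i f+w^{-1}\partial_i(w)f$ on $B$ (a rational function, not necessarily a polynomial); the intersection defining $\mathrm{Im}'\Lambda$ is taken inside the space of functions on $B$. *)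

(* Defs.v *)
From HB Require Import structures.
From mathcomp Require Import all_boot all_order all_algebra.
From mathcomp Require Import all_classical all_reals all_analysis.
From mathcomp Require Import complex.
(* mpoly is not fully imported: its notations clash with those of analysis. *)
From mathcomp Require mpoly.
Import (canonicals, coercions) mpoly.

Set Implicit Arguments.
Unset Strict Implicit.
Unset Printing Implicit Defensive.

Import Order.TTheory GRing.Theory Num.Theory.
Import numFieldNormedType.Exports.

Local Open Scope classical_set_scope.
Local Open Scope ring_scope.
Local Open Scope complex_scope.

Definition mathieu_subspace (R : realType) (A : comAlgType R[i]) (M : set A) : Prop :=
  GRing.submod_closed (mem M) /\
  forall f : A, (forall m : nat, (0 < m)%N -> M (f ^+ m)) ->
    forall g : A, \forall m \near \oo, M (g * f ^+ m).

Notation cpoly R n := (mpoly.mpoly n R[i]).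

Definition ceval (R : realType) (n : nat) (f : cpoly R n) (x : 'rV[R]_n) : R[i] :=
  mpoly.meval (fun i => (x ord0 i)%:C) f.

Notation borelRn R n := (g_sigma_algebraType (@open 'rV[R]_n)).

(* A positive measure on an open set B is represented by a Borel measure on
   R^n, of which only the restriction to the subsets of B is used. *)
Definition cintegrable (R : realType) (n : nat)
    (mu : {measure set (borelRn R n) -> \bar R})
    (B : set 'rV[R]_n) (f : 'rV[R]_n -> R[i]) : Prop :=
  mu.-integrable B (fun x => (complex.Re (f x))%:E) /\
  mu.-integrable B (fun x => (complex.Im (f x))%:E).

Definition cintegral (R : realType) (n : nat)
    (mu : {measure set (borelRn R n) -> \bar R})
    (B : set 'rV[R]_n) (f : 'rV[R]_n -> R[i]) : R[i] :=
  (\int[mu]_(x in B) complex.Re (f x)) +i* (\int[mu]_(x in B) complex.Im (f x)).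

Definition integral_conjecture (R : realType) : Prop :=
  forall (n : nat) (B : set 'rV[R]_n)
    (sigma : {measure set (borelRn R n) -> \bar R}),
    (0 < n)%N -> open B ->
    (forall g : cpoly R n, cintegrable sigma B (ceval g)) ->
    mathieu_subspace [set f : cpoly R n | cintegral sigma B (ceval f) = 0].

Definition hermite_pair (R : realType) (B : set R) (w : R -> R) : Prop :=
  B = setT /\ {in B, w =1 fun x => expR (- x ^+ 2)}.

Definition laguerre_pair (R : realType) (B : set R) (w : R -> R) : Prop :=
  exists alpha : R,
    [/\ -1 < alpha, B = `]0, +oo[%classic
      & {in B, w =1 fun x => x `^ alpha * expR (- x)}].

Definition jacobi_pair (R : realType) (B : set R) (w : R -> R) : Prop :=
  exists alpha beta : R,
    [/\ -1 < alpha, -1 < beta, B = `]-1, 1[%classic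
      & {in B, w =1 fun x => (1 - x) `^ alpha * (1 + x) `^ beta}].

Definition product_weight (R : realType) (pair : set R -> (R -> R) -> Prop)
    (n : nat) (B : set 'rV[R]_n) (w : 'rV[R]_n -> R) : Prop :=
  exists (Bi : 'I_n -> set R) (wi : 'I_n -> R -> R),
    [/\ forall i, pair (Bi i) (wi i),
        B = [set x : 'rV[R]_n | forall i, Bi i (x ord0 i)]
      & {in B, w =1 fun x => \prod_(i < n) wi i (x ord0 i)}].

Definition classical_weight (R : realType) (n : nat)
    (B : set 'rV[R]_n) (w : 'rV[R]_n -> R) : Prop :=
  [\/ product_weight (@hermite_pair R) B w,
      product_weight (@laguerre_pair R) B w
    | product_weight (@jacobi_pair R) B w].

(* Lambda_i f as a function on R^n; it is only meaningful on the open set B,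
   where w is positive and smooth. *)
Definition Lambda (R : realType) (n : nat) (w : 'rV[R]_n -> R) (i : 'I_n)
    (f : cpoly R n) (x : 'rV[R]_n) : R[i] :=
  ceval (mpoly.mderiv i f) x +
  ((w x)^-1 * 'D_(delta_mx ord0 i) w x)%:C * ceval f x.

(* The polynomials whose restriction to B is a sum of functions Lambda_i (f_i):
   the Lambda_i (f_i) need not be polynomial individually. *)
Definition ImLambda' (R : realType) (n : nat) (B : set 'rV[R]_n)
    (w : 'rV[R]_n -> R) : set (cpoly R n) :=
  [set p | exists f : 'I_n -> cpoly R n,
    {in B, ceval p =1 fun x => \sum_(i < n) Lambda w i (f i) x}].

Definition image_conjecture_classical (R : realType) : Prop :=
  forall (n : nat) (B : set 'rV[R]_n) (w : 'rV[R]_n -> R),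
    (0 < n)%N -> classical_weight B w -> mathieu_subspace (ImLambda' B w).

(* Main.v *)
Require Import Defs.
From HB Require Import structures.
From mathcomp Require Import all_boot all_order all_algebra.
From mathcomp Require Import all_classical all_reals all_analysis.
From mathcomp Require Import measurable_realfun complex ring lra.
From mathcomp Require mpoly.
Import (canonicals, coercions) mpoly.

Set Implicit Arguments.
Unset Strict Implicit.
Unset Printing Implicit Defensive.

Import Order.TTheory GRing.Theory Num.Theory.
Import numFieldNormedType.Exports.

Local Open Scope classical_set_scope.
Local Open Scope ring_scope.
Local Open Scope complex_scope.
(** Every classical one-variable weight w satisfies a Pearson equation
    p w' = q w on its interval, with p of degree at most 2 and q of degree at
    most 1:  (p, q) = (1, -2x) for Hermite, (x, alpha - x) for Laguerre and
    (1 - x^2, (beta - alpha) - (alpha + beta) x) for Jacobi.  So w'/w = q/p, and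
    applying Lambda_i to a multiple p(x_i) g clears the denominator:
      Lambda_i (p g) = T_i g := p d_i g + (p' + q) g,
    which is a polynomial.  On a monomial, T_i raises the exponent of x_i by
    one, with a leading coefficient that never vanishes, up to terms of lower
    degree.

    Degenerate case: some q_i shares a root with p_i (alpha = 0 for Laguerre,
    alpha = 0 or beta = 0 for Jacobi).  Cancelling the common factor gives an
    operator that preserves degrees, hence is onto, so the image contains all
    polynomials and is trivially a Mathieu subspace ([ImLambda_degenerate]).

    Nondegenerate case: the image is exactly the kernel of the functional
    f |-> integral of f against the weight ([ImLambda_kernel]), and the integral
    conjecture, for the measure w dx, says that this kernel is a Mathieu
    subspace.  The image lies in the kernel: if sum_i Lambda_i f_i is a
    polynomial, then clearing denominators and setting x_i to a root of p_i,
    where q_i does not vanish, shows that p_i divides f_i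
    ([dvd_of_cleared_sum]); so the sum is sum_i T_i g_i, and the
    integral of T_i g_i is that of the derivative of p w g_i, which vanishes at
    both ends of the interval.  The kernel lies in the image: by the shape of T_i
    on monomials, every f is a constant plus an element of the image
    ([reduce_to_constant]), and the integral of 1 is not zero.

    Since the functional only sees moments, the measure may be any one with
    the moments of w dx.  In one variable it is the measure of density w on the
    line ([pearson_moments]): its moments exist because x^k w is
    bounded by the derivative of a bounded function, and they satisfy the
    recurrence that expresses the vanishing of the integral of (p x^k w)'.  In n
    variables it is the product of these measures, transported to row vectors
    ([product_measure_moments]). *)

(** * Divisibility of multivariate polynomials by univariate factors *)

Notation Xmon m := (mpoly.mpolyX _ m).
Notation Xvar i := (mpoly.mpolyX _ (mpoly.mnm1 i)).
Notation Cst c := (mpoly.mpolyC _ c).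

Section SubstVar.
Variables (K : comNzRingType) (n : nat).
Implicit Types f g : mpoly.mpoly n K.

Definition subst_var (i : 'I_n) (r : K) : mpoly.mpoly n K -> mpoly.mpoly n K :=
  mpoly.comp_mpoly [tuple (if j == i then Cst r else Xvar j) | j < n].

HB.instance Definition _ i r := GRing.RMorphism.on (subst_var i r).

Lemma subst_varC i r c : subst_var i r (Cst c) = Cst c.
Proof. exact: mpoly.comp_mpolyC. Qed.

Lemma subst_varX i r j : subst_var i r (Xvar j) = if j == i then Cst r else Xvar j.
Proof. by rewrite /subst_var mpoly.comp_mpolyXU -tnth_nth tnth_mktuple. Qed.

(** The factor theorem for one variable: the polynomials that satisfy it are
    closed under sums and products, so variables and constants suffice. *)
Lemma subst_varP i r f : exists g, f = subst_var i r f + (Xvar i - Cst r) * g.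
Proof.
pose P f := exists g, f = subst_var i r f + (Xvar i - Cst r) * g.
have PM f1 f2 : P f1 -> P f2 -> P (f1 * f2).
  move=> [g1 e1] [g2 e2].
  exists (g1 * f2 + subst_var i r f1 * g2).
  rewrite rmorphM /=; set s1 := subst_var _ _ f1 in e1 *.
  set s2 := subst_var _ _ f2 in e2 *.
  by rewrite [in LHS]e1 mulrDl [in X in X + _]e2; ring.
have PC c : P (Cst c) by exists 0; rewrite subst_varC mulr0 addr0.
have PX j : P (Xvar j).
  rewrite /P subst_varX; case: eqP => [->|_]; last by exists 0; rewrite mulr0 addr0.
  by exists 1; rewrite mulr1 addrC subrK.
have PXm m : P (Xmon m).
  rewrite mpoly.mpolyXE_id; apply: (big_ind P) => //; first exact: (PC 1).
  move=> j _; elim: (m j) => [|k IH]; first by rewrite expr0; exact: (PC 1).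
  by rewrite exprS; exact: PM.
rewrite -/(P f); elim/mpoly.mpolyind: f => [|c m f _ _ [g e]]; first exact: (PC 0).
have [h eh] := PM _ _ (PC c) (PXm m).
exists (h + g); rewrite -mpoly.mul_mpolyC rmorphD /= {1}e {1}eh; ring.
Qed.
End SubstVar.

Section Algebra.
Variables (K : fieldType) (n : nat).
Local Notation mp := (mpoly.mpoly n K).
Implicit Types (f g : mp) (i j : 'I_n) (m : mpoly.multinom n).

Definition quadratic i (a0 a1 a2 : K) : mp :=
  Cst a0 + Cst a1 * Xvar i + Cst a2 * Xvar i ^+ 2.

Lemma subst_quadratic i r j a0 a1 a2 :
  subst_var i r (quadratic j a0 a1 a2) =
  if j == i then Cst (a0 + a1 * r + a2 * r ^+ 2) else quadratic j a0 a1 a2.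
Proof.
rewrite /quadratic !expr2 !rmorphD !rmorphM /= !subst_varC !subst_varX.
by case: eqP => // _; rewrite !mpoly.mpolyCD !mpoly.mpolyCM.
Qed.

(** Roots are split off one at a time: substituting another root s into
    f = (X_i - r) g gives (s - r) times the substituted g, so s stays a root. *)
Lemma dvd_prod_roots i (rs : seq K) f : uniq rs ->
  (forall r, r \in rs -> subst_var i r f = 0) ->
  exists g, f = \prod_(r <- rs) (Xvar i - Cst r) * g.
Proof.
elim: rs f => [|r rs IH] f; first by exists f; rewrite big_nil mul1r.
rewrite cons_uniq => /andP[rNrs urs] f0.
have [g eg] := subst_varP i r f.
rewrite f0 ?mem_head // add0r in eg.
have [|h eh] := IH g urs.
  move=> s srs; have := f0 s; rewrite inE srs orbT => /(_ isT).
  rewrite eg rmorphM rmorphB /= subst_varC subst_varX eqxx => /eqP.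
  rewrite mulf_eq0 -mpoly.mpolyCB mpoly.mpolyC_eq0 subr_eq0 => /orP[/eqP sr|/eqP//].
  by rewrite -sr srs in rNrs.
by exists h; rewrite big_cons eg {1}eh mulrA.
Qed.

(** The poles of different variables cannot compensate each other.  Here D stands
    for sum_i (F_i + Q_i f_i / P_i), and both sides are multiplied by all the P_i.
    Setting X_i to a root of P_i kills every term but Q_i f_i prod_{j != i} P_j,
    in which only f_i can vanish. *)
Lemma dvd_of_cleared_sum (p0 p1 p2 : 'I_n -> K) (Q F f : 'I_n -> mp) (D : mp)
    (c : 'I_n -> K) (rs : 'I_n -> seq K) :
  let P i := quadratic i (p0 i) (p1 i) (p2 i) in
  (forall i, c i != 0) -> (forall i, uniq (rs i)) ->
  (forall i, P i = Cst (c i) * \prod_(r <- rs i) (Xvar i - Cst r)) ->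
  (forall i r, r \in rs i -> subst_var i r (Q i) != 0) ->
  D * \prod_i P i = \sum_i (P i * F i + Q i * f i) * \prod_(j | j != i) P j ->
  forall i, exists g, f i = P i * g.
Proof.
move=> P c0 urs PE Q0 DE i.
have P0 j : P j != 0.
  rewrite PE mulf_neq0 ?mpoly.mpolyC_eq0 //.
  rewrite prodf_seq_neq0; apply/allP => r _; apply/negP => /eqP.
  (* Substituting r + 1 for X_j turns X_j - r into 1. *)
  move/(congr1 (subst_var j (r + 1))); rewrite rmorphB rmorph0 /= subst_varC subst_varX.
  by rewrite eqxx -mpoly.mpolyCB addrC addKr => /eqP; rewrite mpoly.mpolyC_eq0 oner_eq0.
have [||g eg] := @dvd_prod_roots i (rs i) (f i).
- exact: urs.
- move=> r ri; move/(congr1 (subst_var i r)): DE.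
  have Pir : subst_var i r (P i) = 0.
    rewrite PE rmorphM rmorph_prod /= (big_rem r) //= rmorphB /= !subst_varC subst_varX.
    by rewrite eqxx subrr mul0r mulr0.
  rewrite rmorphM rmorph_prod (bigD1 i) //= Pir mul0r mulr0 rmorph_sum /=.
  rewrite (bigD1 i) //= [X in _ + X]big1 ?addr0; last first.
    move=> j ji; rewrite rmorphM [X in _ * X]rmorph_prod /= (bigD1 i) 1?eq_sym//=.
    by rewrite Pir mul0r mulr0.
  rewrite rmorphM rmorphD !rmorphM /= Pir mul0r add0r rmorph_prod => /esym/eqP.
  rewrite !mulf_eq0 (negbTE (Q0 _ _ ri)) /= => /orP[/eqP//|].
  move=> /prodf_eq0[j ji]; rewrite subst_quadratic (negbTE ji) => /eqP Pj.
  by move: (P0 j); rewrite /P Pj eqxx.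
- exists (Cst (c i)^-1 * g).
  rewrite [RHS]mulrA [P i * _]mulrC PE mulrA -mpoly.mpolyCM mulVf // mul1r.
  exact: eg.
Qed.

(** The operator g |-> p d_i g + (p' + q) g = w^-1 d_i (w p g), where
    p = p0 + p1 X_i + p2 X_i^2, q = q0 + q1 X_i and p w' = q w. *)
Definition pearson_op i p0 p1 p2 q0 q1 g : mp :=
  quadratic i p0 p1 p2 * mpoly.mderiv i g +
  (quadratic i p1 (2 * p2) 0 + quadratic i q0 q1 0) * g.

Lemma pearson_op_monomial i p0 p1 p2 q0 q1 m :
  pearson_op i p0 p1 p2 q0 q1 (Xmon m) =
  ((m i)%:R * p0) *: Xmon (mpoly.mnm_sub m (mpoly.mnm1 i)) +
  (q0 + (m i).+1%:R * p1) *: Xmon m +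
  (q1 + (m i).+2%:R * p2) *: Xmon (mpoly.mnm_add m (mpoly.mnm1 i)).
Proof.
rewrite /pearson_op mpoly.mderivX mpoly.mpolyXD -!mpoly.mul_mpolyC /quadratic.
rewrite !(mpoly.mpolyCD, mpoly.mpolyCM) mpoly.mpolyC0 !mpoly.mpolyC_nat.
have [mi0|mi0] := eqVneq (m i) 0%N; first by rewrite mi0; ring.
have -> : Xmon m = Xmon (mpoly.mnm_sub m (mpoly.mnm1 i)) * Xvar i :> mp.
  rewrite -mpoly.mpolyXD mpoly.submK //; apply/mpoly.mnm_lepP => j.
  by rewrite mpoly.mnm1E; case: eqP => // <-; rewrite lt0n.
by ring.
Qed.
End Algebra.

(** * Reduction of monomials modulo the image *)

Section Reduction.
Variables (K : fieldType) (n : nat).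
Local Notation mp := (mpoly.mpoly n K).
Variable V : mp -> Prop.
Hypothesis V0 : V 0.
Hypothesis Vlin : forall a u v, V u -> V v -> V (a *: u + v).

Let VD u v : V u -> V v -> V (u + v).
Proof. by move=> Vu Vv; rewrite -[u]scale1r; exact: Vlin. Qed.

Let VZ a u : V u -> V (a *: u).
Proof. by move=> Vu; rewrite -[_ *: _]addr0; exact: Vlin. Qed.

(** A Pearson operator applied to X^m produces X^(m + e_i) with a
    nonzero coefficient, plus monomials of smaller degree; so modulo V each
    monomial of positive degree reduces to smaller ones. *)
Lemma reduce_to_constant (p0 p1 p2 q0 q1 : 'I_n -> K) :
  (forall i k, q1 i + k.+2%:R * p2 i != 0) ->
  (forall i m, V (pearson_op i (p0 i) (p1 i) (p2 i) (q0 i) (q1 i) (Xmon m))) ->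
  forall f, exists c, V (f - Cst c).
Proof.
move=> lead VT.
have Vm d : forall m : mpoly.multinom n, (mpoly.mdeg m <= d)%N -> exists c, V (Xmon m - Cst c).
  elim: d => [|d IH] m.
    rewrite leqn0 mpoly.mdeg_eq0 => /eqP ->; exists 1.
    by rewrite mpoly.mpolyX0 mpoly.mpolyC1 subrr.
  move=> mleq; have [m0|[i mi]] : (m = @mpoly.mnm0 n) \/ exists i, m i != 0%N.
    have [/existsP[i mi]|/existsPn H] := boolP [exists i, m i != 0%N]; [by right; exists i|left].
    by apply/mpoly.mnmP => i; rewrite mpoly.mnm0E; apply/eqP; have := H i; rewrite negbK.
    by apply: IH; rewrite m0 mpoly.mdeg0.
  set m' := mpoly.mnm_sub m (mpoly.mnm1 i).
  have mE : m = mpoly.mnm_add m' (mpoly.mnm1 i).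
    rewrite mpoly.submK //; apply/mpoly.mnm_lepP => j.
    by rewrite mpoly.mnm1E; case: eqP => // <-; rewrite lt0n.
  have dm' : (mpoly.mdeg m' <= d)%N.
    by move: mleq; rewrite mE mpoly.mdegD mpoly.mdeg1 addn1.
  have [c1 V1] := IH _ (leq_trans (mpoly.mdegB m' (mpoly.mnm1 i)) dm').
  have [c2 V2] := IH _ dm'.
  have := VT i m'; rewrite pearson_op_monomial -mE.
  set a := _ * _; set b := (X in X *: Xmon m'); set l := (X in _ + X *: Xmon m).
  have l0 : l != 0 by exact: lead.
  clearbody a b l.
  move=> VX; exists (- (a * c1 + b * c2) / l).
  have := VZ l^-1 (VD (VD VX (VZ (- a) V1)) (VZ (- b) V2)).
  congr V; rewrite -!mpoly.mul_mpolyC !(mpoly.mpolyCN, mpoly.mpolyCM, mpoly.mpolyCD).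
  have e : Cst l^-1 * Cst l = 1 :> mp by rewrite -mpoly.mpolyCM mulVf.
  rewrite -[Xmon m in RHS]mul1r -e; ring.
elim/mpoly.mpolyind => [|c m f _ _ [cf Vf]].
  by exists 0; rewrite mpoly.mpolyC0 subrr.
have [cm Vcm] := Vm _ m (leqnn _).
exists (c * cm + cf); have := Vlin c Vcm Vf; congr V.
by rewrite -!mpoly.mul_mpolyC mpoly.mpolyCD mpoly.mpolyCM; ring.
Qed.

(** When p has degree at most 1 and q is constant, the operator sends X^m to
    a nonzero multiple of X^m plus a multiple of X^(m - e_i): it is
    triangular, with nothing left over. *)
Lemma reduce_to_zero (i : 'I_n) (a0 a1 b : K) :
  (forall k, b + k.+1%:R * a1 != 0) ->
  (forall m, V (pearson_op i a0 a1 0 b 0 (Xmon m))) -> forall f, V f.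
Proof.
move=> lead VT.
have Vm d : forall m : mpoly.multinom n, m i = d -> V (Xmon m).
  elim: d => [|d IH] m mi.
    have := VZ (b + 1%:R * a1)^-1 (VT m); congr V.
    rewrite pearson_op_monomial mi !mul0r !mulr0 addr0 !scale0r add0r addr0 scalerA.
    by rewrite mulVf ?scale1r.
  have Vm' : V (Xmon (mpoly.mnm_sub m (mpoly.mnm1 i))).
    by apply: IH; rewrite mpoly.mnmBE mpoly.mnm1E eqxx mi subn1.
  have := VZ (b + d.+2%:R * a1)^-1 (VD (VT m) (VZ (- (d.+1%:R * a0)) Vm')); congr V.
  rewrite pearson_op_monomial mi !mulr0 addr0 scale0r addr0 scaleNr addrAC subrr add0r.
  by rewrite scalerA mulVf ?scale1r.
elim/mpoly.mpolyind => [|c m f _ _ Vf] //.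
by apply: Vlin => //; exact: Vm.
Qed.

End Reduction.

(** * A polynomial that vanishes on a grid is zero *)

Section IdentityTheorem.
Variables (K : fieldType) (n : nat).

(** Extraction of the k-th coefficient of a polynomial of degree less than d from
    its values at d distinct points: the weights are the columns of the inverse of
    the Vandermonde matrix. *)
Lemma dual_weights (s : nat -> K) d : injective s ->
  exists W : 'I_d -> nat -> K, forall j k, (j < d)%N -> (k < d)%N ->
    \sum_(a < d) s a ^+ j * W a k = (j == k)%:R.
Proof.
move=> sI; pose v : 'rV[K]_d := \row_a s a.
pose W := invmx (Vandermonde d v).
have VU : Vandermonde d v \in unitmx.
  rewrite unitmxE det_Vandermonde unitfE.
  apply/prodf_neq0 => i _; apply/prodf_neq0 => j ij; rewrite !mxE subr_eq0.
  by apply/eqP => /sI ji; rewrite ji ltnn in ij.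
exists (fun a k => if (insub k : option 'I_d) is Some k' then W a k' else 0) => j k jd kd.
rewrite insubT /=; have := congr1 (fun M : 'M[K]_d => M (Ordinal jd) (Ordinal kd)) (mulmxV VU).
by rewrite !mxE -val_eqE /= => <-; apply: eq_bigr => a _; rewrite !mxE.
Qed.

(** Tensoring the one-variable weights expresses each coefficient of f as a linear
    combination of its values on the grid. *)
Lemma mpoly_eq0_of_grid (s : nat -> K) (f : mpoly.mpoly n K) : injective s ->
  (forall a : 'I_n -> nat, mpoly.meval (fun i => s (a i)) f = 0) -> f = 0.
Proof.
move=> sI f0; apply/mpoly.mpolyP => m0; rewrite mpoly.mcoeff0.
have [m0f|] := boolP (m0 \in mpoly.msupp f); last exact: mpoly.memN_msupp_eq0.
set d := mpoly.msize f.
have [W WE] := dual_weights d sI.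
have ltd (m : mpoly.multinom n) i : m \in mpoly.msupp f -> (m i < d)%N.
  move=> mf; apply: leq_ltn_trans (mpoly.msize_mdeg_lt mf).
  by rewrite mpoly.mdegE (bigD1 i) //= leq_addr.
have -> : mpoly.mcoeff m0 f = \sum_(m <- mpoly.msupp f)
    mpoly.mcoeff m f * \prod_(i < n) \sum_(a < d) s a ^+ m i * W a (m0 i).
  rewrite (bigD1_seq m0) ?mpoly.msupp_uniq //= [X in X + _](_ : _ = mpoly.mcoeff m0 f); last first.
    by rewrite big1 ?mulr1 // => i _; rewrite WE ?eqxx ?ltd.
  rewrite big_seq_cond big1 ?addr0 // => m /andP[mf mm0].
  have /existsP[i mi] : [exists i, m i != m0 i].
    apply: contraR mm0 => /existsPn mi; apply/eqP/mpoly.mnmP => i.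
    by apply/eqP; have := mi i; rewrite negbK.
  by rewrite (bigD1 i) //= WE ?ltd // (negbTE mi) mul0r mulr0.
under eq_bigr do rewrite bigA_distr_bigA big_distrr /=.
rewrite exchange_big big1 //= => al _.
have := f0 (fun i => al i); rewrite mpoly.mevalE => /(congr1 (fun z => z * \prod_i W (al i) (m0 i))).
rewrite mul0r mulr_suml => fal; rewrite -[RHS]fal; apply: eq_bigr => m _.
by rewrite -mulrA; congr (_ * _); rewrite -big_split.
Qed.
End IdentityTheorem.

(** * The image of Lambda, given a Pearson equation in each variable *)

Section ImageOfLambda.
Variables (R : realType) (n : nat) (B : set 'rV[R]_n) (w : 'rV[R]_n -> R).
Local Notation mp := (cpoly R n).
Implicit Types (i : 'I_n) (x : 'rV[R]_n) (f g : mp).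

Definition real_pearson_op i (p0 p1 p2 q0 q1 : R) : mp -> mp :=
  pearson_op i p0%:C p1%:C p2%:C q0%:C q1%:C.

Lemma cevalD f g x : ceval (f + g) x = ceval f x + ceval g x.
Proof. exact: mpoly.mevalD. Qed.

Lemma cevalM f g x : ceval (f * g) x = ceval f x * ceval g x.
Proof. exact: mpoly.mevalM. Qed.

Lemma cevalZ c f x : ceval (c *: f) x = c * ceval f x.
Proof. exact: mpoly.mevalZ. Qed.

Lemma ceval_sum (I : Type) (r : seq I) (P : pred I) (F : I -> mp) x :
  ceval (\sum_(i <- r | P i) F i) x = \sum_(i <- r | P i) ceval (F i) x.
Proof. exact: (raddf_sum (mpoly.meval _)). Qed.

Lemma ceval_prod (I : Type) (r : seq I) (P : pred I) (F : I -> mp) x :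
  ceval (\prod_(i <- r | P i) F i) x = \prod_(i <- r | P i) ceval (F i) x.
Proof. exact: (rmorph_prod (mpoly.meval _)). Qed.

Lemma ceval_quadratic (i : 'I_n) (a0 a1 a2 : R) x :
  ceval (quadratic i a0%:C a1%:C a2%:C) x =
  (a0 + a1 * x ord0 i + a2 * x ord0 i ^+ 2)%:C.
Proof.
rewrite /quadratic !expr2 !(cevalD, cevalM) /ceval !mpoly.mevalC !mpoly.mevalXU.
by rewrite !(rmorphD, rmorphM).
Qed.

Lemma ceval_affine (i : 'I_n) (a0 a1 : R) x :
  ceval (quadratic i a0%:C a1%:C 0) x = (a0 + a1 * x ord0 i)%:C.
Proof. by rewrite (ceval_quadratic i a0 a1 0) mul0r addr0. Qed.

Lemma mderiv_quadratic (i : 'I_n) (a0 a1 a2 : R[i]) :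
  mpoly.mderiv i (quadratic i a0 a1 a2) = quadratic i a1 (2 * a2) 0 :> mp.
Proof.
rewrite /quadratic expr2 !(mpoly.mderivD, mpoly.mderivM, mpoly.mderivC).
have -> : mpoly.mderiv i (Xvar i) = 1 :> mp.
  rewrite mpoly.mderivX mpoly.mnm1E eqxx scale1r -(mpoly.mpolyX0 n R[i]).
  by congr mpoly.mpolyX; apply/mpoly.mnmP => j; rewrite mpoly.mnmBE subnn mpoly.mnm0E.
rewrite mpoly.mpolyCM mpoly.mpolyC0 mpoly.mpolyC_nat; ring.
Qed.

Lemma Lambda_linear i a f g x :
  Lambda w i (a *: f + g) x = a * Lambda w i f x + Lambda w i g x.
Proof.
rewrite /Lambda mpoly.mderivD mpoly.mderivZ.
by move: (mpoly.mderiv i f) (mpoly.mderiv i g) => f' g'; rewrite !cevalD !cevalZ; ring.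
Qed.

Lemma ImLambda_linear a (u v : mp) :
  ImLambda' B w u -> ImLambda' B w v -> ImLambda' B w (a *: u + v).
Proof.
move=> [f uf] [g vg]; exists (fun i => a *: f i + g i) => x xB.
rewrite cevalD cevalZ uf // vg // mulr_sumr -big_split /=.
by apply: eq_bigr => i _; rewrite Lambda_linear.
Qed.

Lemma Lambda0 i x : Lambda w i 0 x = 0.
Proof. by rewrite /Lambda mpoly.mderiv0 /ceval !mpoly.meval0 mulr0 addr0. Qed.

Lemma ImLambda0 : ImLambda' B w 0.
Proof.
exists (fun=> 0) => x _; rewrite /ceval mpoly.meval0 big1 // => i _.
exact: Lambda0.
Qed.

Lemma ImLambda_submod : GRing.submod_closed (mem (ImLambda' B w)).
Proof.
split; first by rewrite inE; exact: ImLambda0.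
by move=> a u v; rewrite !inE; exact: ImLambda_linear.
Qed.

Lemma Lambda_pearson i (p0 p1 p2 q0 q1 : R) g x :
  (p0 + p1 * x ord0 i + p2 * x ord0 i ^+ 2) *
    ((w x)^-1 * 'D_(delta_mx ord0 i) w x) = q0 + q1 * x ord0 i ->
  Lambda w i (quadratic i p0%:C p1%:C p2%:C * g) x =
  ceval (real_pearson_op i p0 p1 p2 q0 q1 g) x.
Proof.
move=> /(congr1 (real_complex R)); rewrite rmorphM /= => E.
rewrite /Lambda /real_pearson_op /pearson_op mpoly.mderivM mderiv_quadratic.
have -> : 2 * p2%:C = (2 * p2)%:C by rewrite rmorphM /= rmorph_nat.
move: (ceval_quadratic i p0 p1 p2 x) (ceval_affine i p1 (2 * p2) x) (ceval_affine i q0 q1 x).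
move: (quadratic i p0%:C _ _) (quadratic i p1%:C _ _) (quadratic i q0%:C _ _).
move: (mpoly.mderiv i g) => g' P P' Q eP eP' eQ.
rewrite (cevalD (P' * g)) (cevalD (P * g')) !(cevalM P) (cevalM P') (cevalM (P' + Q)).
by rewrite (cevalD P') eP eP' eQ -E; ring.
Qed.

Lemma Lambda_cleared i (p0 p1 p2 q0 q1 : R) f x :
  (p0 + p1 * x ord0 i + p2 * x ord0 i ^+ 2) *
    ((w x)^-1 * 'D_(delta_mx ord0 i) w x) = q0 + q1 * x ord0 i ->
  Lambda w i f x * ceval (quadratic i p0%:C p1%:C p2%:C) x =
  ceval (quadratic i p0%:C p1%:C p2%:C * mpoly.mderiv i f +
         quadratic i q0%:C q1%:C 0 * f) x.
Proof.
move=> /(congr1 (real_complex R)); rewrite rmorphM /= => E.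
move: (ceval_quadratic i p0 p1 p2 x) (ceval_affine i q0 q1 x).
rewrite /Lambda; move: (quadratic i p0%:C _ _) (quadratic i q0%:C _ _).
move: (mpoly.mderiv i f) => f' P Q eP eQ.
by rewrite cevalD (cevalM P) (cevalM Q) eP eQ -E; ring.
Qed.

Lemma ImLambda_pearson i (p0 p1 p2 q0 q1 : R) g :
  (forall x, B x -> (p0 + p1 * x ord0 i + p2 * x ord0 i ^+ 2) *
    ((w x)^-1 * 'D_(delta_mx ord0 i) w x) = q0 + q1 * x ord0 i) ->
  ImLambda' B w (real_pearson_op i p0 p1 p2 q0 q1 g).
Proof.
move=> E; exists (fun j => if j == i then quadratic i p0%:C p1%:C p2%:C * g else 0).
move=> x; rewrite inE => xB; rewrite (bigD1 i) //= eqxx (Lambda_pearson _ (E x xB)).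
rewrite big1 ?addr0 // => j /negbTE ->; exact: Lambda0.
Qed.

(** The hypothesis says that the logarithmic derivative b / (a0 + a1 x_i) of w has
    its numerator constant, that is, that the common factor of p and q has been
    cancelled. *)
Lemma ImLambda_degenerate i (a0 a1 b : R) :
  (forall x, B x -> (a0 + a1 * x ord0 i) *
    ((w x)^-1 * 'D_(delta_mx ord0 i) w x) = b) ->
  (forall k, b + k.+1%:R * a1 != 0) -> forall f, ImLambda' B w f.
Proof.
move=> E lead; apply: (@reduce_to_zero _ _ _ ImLambda0 ImLambda_linear i a0%:C a1%:C b%:C).
  move=> k; rewrite -(rmorph_nat (real_complex R)) -rmorphM -rmorphD /=.
  by rewrite fmorph_eq0.
move=> m.
by apply: (ImLambda_pearson (p2 := 0) (q1 := 0)) => x xB; rewrite !mul0r !addr0; exact: E.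
Qed.

Hypothesis unit_cube : forall x, (forall i, 0 < x ord0 i < 1) -> B x.

Lemma ceval_eq_on (f g : mp) : {in B, ceval f =1 ceval g} -> f = g.
Proof.
move=> fg; apply/eqP; rewrite -subr_eq0; apply/eqP.
(* The grid points 1 / (k + 2) all lie in the open unit interval. *)
pose s k : R[i] := (k.+2%:R^-1)%:C.
apply: (@mpoly_eq0_of_grid _ _ s).
  move=> k l /(congr1 (@complex.Re R)) /= /(can_inj invrK)/eqP.
  by rewrite eqr_nat => /eqP[].
move=> a; pose x : 'rV[R]_n := \row_i (a i).+2%:R^-1.
have xB : x \in B.
  rewrite inE; apply: unit_cube => i; rewrite mxE invr_gt0 ltr0n /=.
  by rewrite invf_lt1 ?ltr1n ?ltr0n.
have := fg x xB; rewrite /ceval => fgx.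
rewrite mpoly.mevalB; apply/eqP; rewrite subr_eq0; apply/eqP.
by rewrite -[RHS]/(mpoly.meval _ g); under [LHS]mpoly.meval_eq do
   rewrite -[s _]/((_)%:C); move: fgx;
   under mpoly.meval_eq do rewrite mxE;
   under [RHS]mpoly.meval_eq do rewrite mxE.
Qed.

Variables (p0 p1 p2 q0 q1 : 'I_n -> R).
Hypothesis pearson : forall i x, B x ->
  (p0 i + p1 i * x ord0 i + p2 i * x ord0 i ^+ 2) *
  ((w x)^-1 * 'D_(delta_mx ord0 i) w x) = q0 i + q1 i * x ord0 i.
Variables (c : 'I_n -> R) (rs : 'I_n -> seq R).
Hypothesis c_neq0 : forall i, c i != 0.
Hypothesis uniq_rs : forall i, uniq (rs i).
Hypothesis factorization : forall i t,
  p0 i + p1 i * t + p2 i * t ^+ 2 = c i * \prod_(r <- rs i) (t - r).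
Hypothesis nondegenerate : forall i r, r \in rs i -> q0 i + q1 i * r != 0.

Let P i : mp := quadratic i (p0 i)%:C (p1 i)%:C (p2 i)%:C.
Let T i : mp -> mp := real_pearson_op i (p0 i) (p1 i) (p2 i) (q0 i) (q1 i).

(** An identity of polynomial functions, transferred to formal polynomials. *)
Lemma quadratic_factorization i :
  P i = Cst (c i)%:C * \prod_(r <- map (real_complex R) (rs i)) (Xvar i - Cst r).
Proof.
apply: ceval_eq_on => x _; rewrite cevalM {1}/P ceval_quadratic factorization rmorphM /=.
rewrite ceval_prod big_map rmorph_prod /ceval mpoly.mevalC; congr (_ * _).
by apply: eq_bigr => r _; rewrite mpoly.mevalB mpoly.mevalXU mpoly.mevalC -rmorphB.
Qed.

(** Although the Lambda_i (f_i) need not be polynomials separately, their sum being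
    one forces p_i to divide f_i. *)
Lemma ImLambda_pearson_sum (f : mp) : ImLambda' B w f ->
  exists g : 'I_n -> mp, f = \sum_i T i (g i).
Proof.
move=> [h fh].
pose Q i : mp := quadratic i (q0 i)%:C (q1 i)%:C 0.
have hP : forall i, exists g, h i = P i * g.
  apply: (@dvd_of_cleared_sum _ _ (fun i => (p0 i)%:C) (fun i => (p1 i)%:C)
    (fun i => (p2 i)%:C) Q (fun i => mpoly.mderiv i (h i)) h f (fun i => (c i)%:C)
    (fun i => map (real_complex R) (rs i))).
  - by move=> i; rewrite fmorph_eq0.
  - by move=> i; rewrite map_inj_uniq //; exact: (fmorph_inj (real_complex R)).
  - exact: quadratic_factorization.
  - move=> i _ /mapP[r ri ->]; rewrite /Q subst_quadratic eqxx mpoly.mpolyC_eq0.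
    by rewrite -!rmorphM -!rmorphD mul0r addr0 /= fmorph_eq0; exact: nondegenerate.
  - apply: ceval_eq_on => x xB; rewrite cevalM fh // ceval_sum mulr_suml.
    apply: eq_bigr => i _; rewrite cevalM !ceval_prod [X in _ * X = _](bigD1 i) //=.
    rewrite mulrA; congr (_ * _); apply: Lambda_cleared; apply: pearson.
    by rewrite inE in xB.
have {hP} [g hg] := choice hP.
exists g; apply: ceval_eq_on => x xB; rewrite fh // ceval_sum; apply: eq_bigr => i _.
by rewrite hg; apply: Lambda_pearson; apply: pearson; rewrite inE in xB.
Qed.

Variable L : mp -> R[i].
Hypothesis L_linear : forall a u v, L (a *: u + v) = a * L u + L v.
Hypothesis L1 : L 1 != 0.
Hypothesis LT : forall i m, L (T i (Xmon m)) = 0.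
Hypothesis leading : forall i k, q1 i + k.+2%:R * p2 i != 0.

(** If L f = 0, write f = a + v with a constant and v in the image; L vanishes
    on v, so a L(1) = 0 and a = 0. *)
Lemma ImLambda_kernel : ImLambda' B w = [set f | L f = 0].
Proof.
have L0 : L 0 = 0.
  by have := L_linear (-1) 0 0; rewrite scaler0 addr0 mulN1r addNr.
have LTg i g : L (T i g) = 0.
  elim/mpoly.mpolyind: g => [|a m g _ _ IH].
    by rewrite /T /real_pearson_op /pearson_op mpoly.mderiv0 !mulr0 addr0.
  have -> : T i (a *: Xmon m + g) = a *: T i (Xmon m) + T i g.
    rewrite /T /real_pearson_op /pearson_op mpoly.mderivD mpoly.mderivZ.
    move: (quadratic _ _ _ _) (quadratic _ _ _ _) (quadratic _ _ _ _) => P1 P2 P3.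
    by rewrite -!mpoly.mul_mpolyC; ring.
  by rewrite L_linear LT IH mulr0 addr0.
apply/seteqP; split => f /=.
  move=> /ImLambda_pearson_sum[g ->]; elim/big_ind : _ => // u v Lu Lv.
  by have := L_linear 1 u v; rewrite scale1r mul1r Lu Lv addr0.
move=> Lf.
have [a fa] : exists a, ImLambda' B w (f - Cst a).
  apply: (reduce_to_constant ImLambda0 ImLambda_linear (p0 := fun i => (p0 i)%:C)
    (p1 := fun i => (p1 i)%:C) (p2 := fun i => (p2 i)%:C) (q0 := fun i => (q0 i)%:C)
    (q1 := fun i => (q1 i)%:C)).
    move=> i k; rewrite -(rmorph_nat (real_complex R)) -rmorphM -rmorphD /= fmorph_eq0.
    exact: leading.
  by move=> i m; apply: ImLambda_pearson => x xB; exact: pearson.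
have : L (f - Cst a) = 0.
  move: fa => /ImLambda_pearson_sum[g ->]; elim/big_ind : _ => // u v Lu Lv.
  by have := L_linear 1 u v; rewrite scale1r mul1r Lu Lv addr0.
have -> : f - Cst a = (- a) *: 1 + f by rewrite -mpoly.mul_mpolyC mulr1 addrC mpoly.mpolyCN.
rewrite L_linear Lf addr0 => /eqP; rewrite mulf_eq0 oppr_eq0 (negbTE L1) orbF => /eqP a0.
by move: fa; rewrite a0 mpoly.mpolyC0 subr0.
Qed.
End ImageOfLambda.

(** * Product measures on row vectors *)

Section BorelRows.
Variable R : realType.

Lemma measurable_coord n (i : 'I_n) :
  measurable_fun setT (fun v : borelRn R n => (v : 'rV[R]_n) ord0 i).
Proof.
apply: (measurability _ (RGenOInfty.measurableE R)) => _ [_ [a ->] <-].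
rewrite setTI; apply: sub_sigma_algebra.
have /continuousP := @coord_continuous R 1 n ord0 i.
exact.
Qed.

(** By density of the rationals, an open set of row vectors is a countable union of
    the cubes of rational centre and radius 1 / (k + 1) that it contains, and the
    preimage of a cube is a finite intersection of measurable sets. *)
Lemma measurable_fun_rV d (T : measurableType d) n (f : T -> borelRn R n) :
  (forall i, measurable_fun setT (fun t => (f t : 'rV[R]_n) ord0 i)) ->
  measurable_fun setT f.
Proof.
move=> mf; apply: (@measurability d _ T (borelRn R n) setT f (@open 'rV[R]_n)) => [|_ [A oA <-]]; first by [].
rewrite setTI.
pose box (qk : 'rV[rat]_n * nat) : set 'rV[R]_n :=
  [set v | forall i, ball (ratr (qk.1 ord0 i) : R) qk.2.+1%:R^-1 (v ord0 i)].
pose F qk := if `[< box qk `<=` A >] then f @^-1` box qk else set0.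
have -> : f @^-1` A = \bigcup_qk F qk.
  apply/seteqP; split => t /=; last first.
    by move=> [qk _]; rewrite /F; case: asboolP => // bA; exact: bA.
  move=> Aft; have : nbhs (f t : 'rV[R]_n) A by exact: open_nbhs_nbhs.
  move=> /nbhs_ballP[e e0 eA].
  have [k ke] : exists k : nat, k.+1%:R^-1 < e / 2.
    have e20 : 0 < e / 2 by rewrite divr_gt0.
    exists (Num.truncn (e / 2)^-1).
    by rewrite invf_plt ?posrE// truncnS_gt.
  have qP i : exists q : rat, ball (ratr q : R) k.+1%:R^-1 ((f t : 'rV[R]_n) ord0 i).
    have k0 : (0 : R) < k.+1%:R^-1 by [].
    set y := _ ord0 i.
    have /rat_in_itvoo[q] : y - k.+1%:R^-1 < y + k.+1%:R^-1 by rewrite ltrBlDr -addrA ltrDl addr_gt0.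
    rewrite in_itv /= => /andP[q1 q2]; exists q.
    by rewrite /ball /= ltr_distl q1 q2.
  have [q hq] := choice qP.
  exists (\row_i q i, k) => //; rewrite /F ifT; last first.
    apply/asboolP => v bv; apply: eA; split => // i j.
    rewrite (ord1 i); apply: (@ball_splitr R R (ratr (q j) : R)).
      by apply: le_ball (hq j); exact: ltW.
    have := bv j; rewrite mxE; apply: le_ball; exact: ltW.
  by move=> i /=; rewrite mxE; exact: hq.
apply: countable_bigcupT_measurable => // qk.
rewrite /F; case: asboolP => // _.
have -> : f @^-1` box qk = \bigcap_(i in [set: 'I_n])
    ((fun t => (f t : 'rV[R]_n) ord0 i) @^-1` ball (ratr (qk.1 ord0 i) : R) qk.2.+1%:R^-1).
  apply/seteqP; split => t /= h; first by move=> i _; exact: h.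
  by move=> i; exact: (h i I).
apply: fin_bigcap_measurable => // i _.
rewrite -[X in measurable X]setTI; apply: mf => //.
exact: measurable_ball.
Qed.

Lemma measurable_monomial n (k : 'I_n -> nat) :
  measurable_fun setT (fun v : borelRn R n => \prod_(i < n) (v : 'rV[R]_n) ord0 i ^+ k i).
Proof.
apply: measurable_prod => i _; apply: measurable_funX; exact: measurable_coord.
Qed.

(** Fubini for a function with separated variables. *)
Lemma integrable_integral_tensor d1 d2 (T1 : measurableType d1) (T2 : measurableType d2)
    (m1 : {finite_measure set T1 -> \bar R}) (m2 : {finite_measure set T2 -> \bar R})
    (f1 : T1 -> R) (f2 : T2 -> R) :
  m1.-integrable setT (EFin \o f1) -> m2.-integrable setT (EFin \o f2) ->
  (m1 \x m2)%E.-integrable setT (fun z => (f1 z.1 * f2 z.2)%:E) /\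
  (\int[(m1 \x m2)%E]_z (f1 z.1 * f2 z.2)%:E =
   \int[m1]_x (f1 x)%:E * \int[m2]_y (f2 y)%:E)%E.
Proof.
move=> if1 if2.
have mf1 : measurable_fun setT f1 by have /integrableP[/measurable_EFinP] := if1.
have mf2 : measurable_fun setT f2 by have /integrableP[/measurable_EFinP] := if2.
have mf : measurable_fun setT (fun z : T1 * T2 => (f1 z.1 * f2 z.2)%:E).
  apply/measurable_EFinP; apply: measurable_funM.
    by apply: measurableT_comp => //; exact: measurable_fst.
  by apply: measurableT_comp => //; exact: measurable_snd.
have intf : (m1 \x m2)%E.-integrable setT (fun z => (f1 z.1 * f2 z.2)%:E).
  apply/integrable12ltyP => //=.
  have -> : (\int[m1]_x \int[m2]_y `|(f1 x * f2 y)%:E| =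
             \int[m1]_x (`|f1 x|%:E * \int[m2]_y `|(f2 y)%:E|))%E.
    apply: eq_integral => x _; rewrite -ge0_integralZl_EFin //.
      by apply: eq_integral => y _; rewrite EFinM abseM.
    by apply: measurableT_comp => //; exact/measurable_EFinP.
  have /integrableP[_ f1oo] := if1; have /integrableP[_ f2oo] := if2.
  rewrite ge0_integralZr //; last 2 first.
    by apply/measurable_EFinP; exact: measurableT_comp.
    exact: integral_ge0.
  by apply: lte_mul_pinfty => //; [exact: integral_ge0|rewrite ge0_fin_numE// integral_ge0].
split=> //; rewrite -integral12_prod_meas1 // /fubini_F /=.
under eq_integral => x _.
  under eq_integral do rewrite EFinM.
  rewrite integralZl //; over.
have /fineK <- : (\int[m2]_y (f2 y)%:E)%E \is a fin_num by exact: integrable_fin_num.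
by rewrite integralZr.
Qed.

Definition cons_rV n (z : measurableTypeR R * borelRn R n) : borelRn R n.+1 :=
  \row_i (if unlift ord0 i is Some j then (z.2 : 'rV[R]_n) ord0 j else z.1).

Lemma measurable_cons_rV n : measurable_fun setT (@cons_rV n).
Proof.
apply: measurable_fun_rV => i; rewrite /cons_rV.
under eq_fun do rewrite mxE.
case: (unliftP ord0 i) => [j _|_]; last exact: measurable_fst.
exact: (measurableT_comp (measurable_coord j) measurable_snd).
Qed.

HB.instance Definition _ n :=
  isMeasurableFun.Build _ _ _ _ (@cons_rV n) (@measurable_cons_rV n).

Section ConsMeasure.
Variables (n : nat) (mu : {finite_measure set (measurableTypeR R) -> \bar R}).
Variable sigma : {finite_measure set (borelRn R n) -> \bar R}.

(** The product measure, moved from pairs to row vectors so that it lives on the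
    Borel sets of the row vectors. *)
Definition cons_measure := pushforward (mu \x sigma)%E (@cons_rV n).

Let cons_measure0 : cons_measure set0 = 0%E.
Proof. exact: measure0. Qed.

Let cons_measure_ge0 A : (0 <= cons_measure A)%E.
Proof. exact: measure_ge0. Qed.

Let cons_measure_sigma_additive : semi_sigma_additive cons_measure.
Proof. exact: measure_semi_sigma_additive. Qed.

HB.instance Definition _ := isMeasure.Build _ _ _ cons_measure
  cons_measure0 cons_measure_ge0 cons_measure_sigma_additive.

Let cons_measure_fin : fin_num_fun cons_measure.
Proof.
apply: lty_fin_num_fun => /=; rewrite /cons_measure /pushforward preimage_setT -setXTT.
rewrite product_measure1E // lte_mul_pinfty // ?fin_num_measure //.
by rewrite ltey_eq fin_num_measure.
Qed.

HB.instance Definition _ := @Measure_isFinite.Build _ _ _ cons_measure cons_measure_fin.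

End ConsMeasure.

(** Induction on n, adding the variable of index 0 in front. *)
Lemma product_measure_moments n (mu : 'I_n -> {finite_measure set (measurableTypeR R) -> \bar R})
    (M : 'I_n -> nat -> R) :
  (forall i k, (mu i).-integrable setT (fun x => (x ^+ k)%:E)) ->
  (forall i k, \int[mu i]_x (x ^+ k)%:E = (M i k)%:E)%E ->
  exists sigma : {finite_measure set (borelRn R n) -> \bar R},
    forall k : 'I_n -> nat,
      sigma.-integrable setT (fun v => (\prod_(i < n) (v : 'rV[R]_n) ord0 i ^+ k i)%:E) /\
      (\int[sigma]_v (\prod_(i < n) (v : 'rV[R]_n) ord0 i ^+ k i)%:E =
       (\prod_(i < n) M i (k i))%:E)%E.
Proof.
elim: n mu M => [|n IH] mu M imu Mmu.
  exists (dirac (0 : borelRn R 0)) => k.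
  have -> : (fun v : borelRn R 0 => (\prod_(i < 0) (v : 'rV[R]_0) ord0 i ^+ k i)%:E) =
            cst 1%:E by apply/funext => v; rewrite big_ord0.
  rewrite big_ord0; split; first exact: finite_measure_integrable_cst.
  by rewrite integral_cst //= /dirac indicE in_setT mul1e.
have [sigma sigmaP] := IH (fun i => mu (lift ord0 i)) (fun i => M (lift ord0 i))
  (fun i => imu (lift ord0 i)) (fun i => Mmu (lift ord0 i)).
exists (cons_measure (mu ord0) sigma) => k.
have [isig Msig] := sigmaP (fun i => k (lift ord0 i)).
have [itens Mtens] := integrable_integral_tensor (imu ord0 (k ord0)) isig.
set F := fun v => _.
have FE : F \o @cons_rV n = fun z => (z.1 ^+ k ord0 *
    \prod_(i < n) (z.2 : 'rV[R]_n) ord0 i ^+ k (lift ord0 i))%:E.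
  apply/funext => z; rewrite /F /= big_ord_recl /cons_rV mxE unlift_none.
  by congr (_ * _)%:E; apply: eq_bigr => i _; rewrite mxE liftK.
have mF : measurable_fun setT F by apply/measurable_EFinP; exact: measurable_monomial.
have iF : ((mu ord0) \x sigma)%E.-integrable (@cons_rV n @^-1` setT) (F \o @cons_rV n).
  by rewrite preimage_setT FE.
split; first exact: integrable_pushforward.
rewrite /cons_measure integral_pushforward // preimage_setT FE Mtens Mmu Msig.
by rewrite -EFinM big_ord_recl.
Qed.

End BorelRows.

(** * Integration of complex polynomials *)

Section ComplexIntegral.
Variables (R : realType) (n : nat) (mu : {measure set (borelRn R n) -> \bar R}).
Local Notation mp := (cpoly R n).
Implicit Types (u v : 'rV[R]_n -> R[i]) (a : R[i]).

Let Re_comb a u v x : complex.Re (a * u x + v x) =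
  complex.Re a * complex.Re (u x) + (- complex.Im a * complex.Im (u x) + complex.Re (v x)).
Proof. by case: a (u x) (v x) => [a b] [c d] [e f] /=; ring. Qed.

Let Im_comb a u v x : complex.Im (a * u x + v x) =
  complex.Re a * complex.Im (u x) + (complex.Im a * complex.Re (u x) + complex.Im (v x)).
Proof. by case: a (u x) (v x) => [a b] [c d] [e f] /=; ring. Qed.

Let integrable_comb3 (a b : R) (f g h : borelRn R n -> R) :
  mu.-integrable setT (EFin \o f) -> mu.-integrable setT (EFin \o g) ->
  mu.-integrable setT (EFin \o h) ->
  mu.-integrable setT (fun x => (a * f x + (b * g x + h x))%:E).
Proof.
move=> If Ig Ih.
apply: (@integrableD _ _ _ mu setT measurableT (fun x => (a * f x)%:E)
  (fun x => (b * g x + h x)%:E)).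
  exact: (@integrableZl _ _ _ mu setT measurableT a (EFin \o f)).
apply: (@integrableD _ _ _ mu setT measurableT (fun x => (b * g x)%:E) (EFin \o h)) => //.
exact: (@integrableZl _ _ _ mu setT measurableT b (EFin \o g)).
Qed.

Let Rintegral_comb3 (a b : R) (f g h : borelRn R n -> R) :
  mu.-integrable setT (EFin \o f) -> mu.-integrable setT (EFin \o g) ->
  mu.-integrable setT (EFin \o h) ->
  \int[mu]_x (a * f x + (b * g x + h x)) =
  a * (\int[mu]_x f x) + (b * (\int[mu]_x g x) + \int[mu]_x h x).
Proof.
move=> If Ig Ih.
have Iaf : mu.-integrable setT (EFin \o (fun x => a * f x)).
  exact: (@integrableZl _ _ _ mu setT measurableT a (EFin \o f)).
have Ibg : mu.-integrable setT (EFin \o (fun x => b * g x)).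
  exact: (@integrableZl _ _ _ mu setT measurableT b (EFin \o g)).
have Ibgh : mu.-integrable setT (EFin \o (fun x => b * g x + h x)).
  exact: (@integrableD _ _ _ mu setT measurableT (fun x => (b * g x)%:E) (EFin \o h)).
by rewrite RintegralD // RintegralZl // RintegralD // RintegralZl.
Qed.

Lemma cintegrable_comb a u v : cintegrable mu setT u -> cintegrable mu setT v ->
  cintegrable mu setT (fun x => a * u x + v x).
Proof.
move=> [Ru Iu] [Rv Iv]; split.
  under eq_fun do rewrite Re_comb; exact: integrable_comb3.
under eq_fun do rewrite Im_comb; exact: integrable_comb3.
Qed.

Lemma cintegral_comb a u v : cintegrable mu setT u -> cintegrable mu setT v ->
  cintegral mu setT (fun x => a * u x + v x) =
  a * cintegral mu setT u + cintegral mu setT v.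
Proof.
move=> [Ru Iu] [Rv Iv]; rewrite /cintegral.
under eq_Rintegral do rewrite Re_comb.
under [X in _ +i* X]eq_Rintegral do rewrite Im_comb.
rewrite !Rintegral_comb3 //; case: (a) => [b c] /=.
by apply/eqP; rewrite eq_complex /=; apply/andP; split; apply/eqP; ring.
Qed.

Variable M : 'I_n -> nat -> R.
Hypothesis imon : forall k : 'I_n -> nat,
  mu.-integrable setT (fun x => (\prod_(i < n) (x : 'rV[R]_n) ord0 i ^+ k i)%:E) /\
  (\int[mu]_x (\prod_(i < n) (x : 'rV[R]_n) ord0 i ^+ k i)%:E =
   (\prod_(i < n) M i (k i))%:E)%E.

Let ceval_monomial (m : mpoly.multinom n) x :
  ceval (Xmon m : mp) x = (\prod_(i < n) x ord0 i ^+ m i)%:C.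
Proof.
rewrite /ceval mpoly.mevalX rmorph_prod; apply: eq_bigr => i _.
by rewrite rmorphXn.
Qed.

Lemma cintegrable_monomial (m : mpoly.multinom n) :
  cintegrable mu setT (ceval (Xmon m : mp)).
Proof.
split; under eq_fun do rewrite ceval_monomial /=.
  exact: (imon m).1.
exact: integrable0.
Qed.

Lemma cintegrable_poly (f : mp) : cintegrable mu setT (ceval f).
Proof.
elim/mpoly.mpolyind: f => [|a m f _ _ IH].
  by split; under eq_fun do rewrite /ceval mpoly.meval0 /=; exact: integrable0.
have -> : ceval (a *: Xmon m + f) = fun x => a * ceval (Xmon m : mp) x + ceval f x.
  by apply/funext => x; rewrite cevalD cevalZ.
by apply: cintegrable_comb => //; exact: cintegrable_monomial.
Qed.

Lemma cintegral_poly_linear a (f g : mp) : cintegral mu setT (ceval (a *: f + g)) =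
  a * cintegral mu setT (ceval f) + cintegral mu setT (ceval g).
Proof.
rewrite -cintegral_comb; try exact: cintegrable_poly.
by congr (cintegral _ _ _); apply/funext => x; rewrite cevalD cevalZ.
Qed.

Lemma cintegral_monomial (m : mpoly.multinom n) :
  cintegral mu setT (ceval (Xmon m : mp)) = (\prod_(i < n) M i (m i))%:C.
Proof.
rewrite /cintegral.
under eq_Rintegral do rewrite ceval_monomial /=.
under [X in _ +i* X]eq_Rintegral do rewrite ceval_monomial /=.
by rewrite /Rintegral (imon m).2 integral0.
Qed.
End ComplexIntegral.

(** * Measures with a density *)

Section Density.
Variable R : realType.
Local Notation leb := (@lebesgue_measure R).
Local Open Scope ereal_scope.

(** The Radon-Nikodym derivative of the set function A |-> integral of W over A is
    almost everywhere W, so the change of variables for that derivative gives the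
    formula for nonnegative f; a general f is the difference of its positive and
    negative parts. *)
Lemma density_measure (W : R -> R) :
  measurable_fun setT W -> (forall x, (0 <= W x)%R) -> leb.-integrable setT (EFin \o W) ->
  exists nu : {finite_measure set (measurableTypeR R) -> \bar R},
    forall f : R -> R, measurable_fun setT f ->
      leb.-integrable setT (fun x => (f x * W x)%:E) ->
      nu.-integrable setT (EFin \o f) /\
      \int[nu]_x (f x)%:E = \int[leb]_x (f x * W x)%:E.
Proof.
move=> mW W0 iW.
pose nu0 (A : set (measurableTypeR R)) := \int[leb]_(x in A) (W x)%:E.
have nu00 : nu0 set0 = 0 by rewrite /nu0 integral_set0.
have nu0_ge0 A : 0 <= nu0 A by apply: integral_ge0 => x _; rewrite lee_fin.
have nu0_sig : semi_sigma_additive nu0.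
  apply: semi_sigma_additive_nng_induced => [|x]; first exact/measurable_EFinP.
  by rewrite lee_fin.
have nu0_fin : fin_num_fun nu0.
  move=> A mA; apply: integrable_fin_num => //.
  exact: integrableS iW.
pose m1 := isMeasure.Build _ _ _ nu0 nu00 nu0_ge0 nu0_sig.
pose nu1 : {measure set (measurableTypeR R) -> \bar R} := HB.pack nu0 m1.
pose m2 := @Measure_isFinite.Build _ _ _ nu1 nu0_fin.
pose nu : {finite_measure set (measurableTypeR R) -> \bar R} := HB.pack nu0 m1 m2.
exists nu => f mf ifW.
have dom : nu `<< leb.
  apply/null_content_dominatesP => A mA A0; rewrite /nu /= /nu0.
  by apply: null_set_integral => //; apply/measurable_EFinP; exact: measurable_funTS.
pose g := Radon_Nikodym_SigmaFinite.f nu leb.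
have gW : ae_eq leb setT g (EFin \o W).
  apply: integral_ae_eq => //; first exact: Radon_Nikodym_SigmaFinite.f_integrable.
    exact/measurable_EFinP.
  by move=> E _ mE; rewrite -Radon_Nikodym_SigmaFinite.f_integral.
have mg : measurable_fun setT g.
  exact: (measurable_int leb (Radon_Nikodym_SigmaFinite.f_integrable dom)).
have ge0 (h : R -> R) : (forall x, 0 <= h x)%R -> measurable_fun setT h ->
    \int[nu]_x (h x)%:E = \int[leb]_x (h x * W x)%:E.
  move=> h0 mh; rewrite -(Radon_Nikodym_SigmaFinite.change_of_variables dom) //; last exact/measurable_EFinP.
  apply: ae_eq_integral => //.
  - by apply: emeasurable_funM => //; exact/measurable_EFinP.
  - by apply/measurable_EFinP; exact: measurable_funM.
  - under [X in ae_eq _ _ _ X]eq_fun do rewrite EFinM.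
    exact: ae_eqe_mul2l gW.
have integ (h : R -> R) : measurable_fun setT h ->
    leb.-integrable setT (fun x => (h x * W x)%:E) -> nu.-integrable setT (EFin \o h).
  move=> mh ihW; apply/integrableP; split; first exact/measurable_EFinP.
  have /integrableP[_] := ihW.
  under eq_integral do rewrite abse_EFin normrM (ger0_norm (W0 _)).
  rewrite -(ge0 (fun x => `|h x|%R)) //.
  exact: measurableT_comp.
split; first exact: integ.
pose p x := Num.max (f x) 0%R; pose q x := Num.max (- f x)%R 0%R.
have fpq x : f x = (p x - q x)%R by rewrite /p /q; case: (lerP (f x) 0); case: (lerP (- f x) 0) => *; lra.
have mp : measurable_fun setT p by apply: measurable_maxr.
have mq : measurable_fun setT q by apply: measurable_maxr => //; exact: measurableT_comp.
have sub (h : R -> R) : measurable_fun setT h -> (forall x, `|h x| <= `|f x|)%R ->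
    leb.-integrable setT (fun x => (h x * W x)%:E).
  move=> mh hf; apply: le_integrable ifW => //.
    by apply/measurable_EFinP; exact: measurable_funM.
  by move=> x _; rewrite !abse_EFin lee_fin !normrM ler_wpM2r.
have ip : leb.-integrable setT (fun x => (p x * W x)%:E).
  apply: sub => // x; by rewrite /p; case: (lerP (f x) 0) => _; rewrite ?normr0.
have iq : leb.-integrable setT (fun x => (q x * W x)%:E).
  apply: sub => // x; by rewrite /q; case: (lerP (- f x) 0) => _; rewrite ?normr0 ?normrN.
under eq_integral do rewrite fpq EFinB.
rewrite integralB //; [|exact: integ..].
rewrite ge0 //; last by move=> x; rewrite /p le_max lexx orbT.
rewrite ge0 //; last by move=> x; rewrite /q le_max lexx orbT.
rewrite -integralB //; apply: eq_integral => x _.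
by rewrite [in RHS]fpq mulrBl.
Qed.
End Density.

(** * Integration over an open interval exhausted by segments *)

Section Exhaustion.
Variable R : realType.
Local Notation leb := (@lebesgue_measure R).
Variables (B : set R) (a b : nat -> R).
Hypothesis ab : forall n, a n < b n.
Hypothesis nd_ab : forall n m, (n <= m)%N -> a m <= a n /\ b n <= b m.
Hypothesis cover_ab : B = \bigcup_n `[a n, b n]%classic.

Let sub n x : x \in `[a n, b n] -> B x.
Proof. by move=> xab; rewrite cover_ab; exists n. Qed.

Let nd_itv : {homo (fun n => `[a n, b n]%classic) : n m / (n <= m)%N >-> (n <= m)%O}.
Proof.
move=> n m /nd_ab[aa bb]; apply/subsetPset => x /=; rewrite !in_itv /= => /andP[ax xb].
by rewrite (le_trans aa ax) (le_trans xb bb).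
Qed.

Let mB : measurable B.
Proof. by rewrite cover_ab; apply: bigcupT_measurable => n; exact: measurable_itv. Qed.

Lemma exhaustion_measurable_fun (f : R -> R) : {in B, continuous f} -> measurable_fun B f.
Proof.
move=> cf; rewrite cover_ab; apply/measurable_fun_bigcup => // n.
apply: subspace_continuous_measurable_fun => //.
by apply: continuous_in_subspaceT => x; rewrite inE => /sub xB; apply: cf; rewrite inE.
Qed.

Lemma FTC2_itv (F f : R -> R) n : {in B, continuous f} ->
  (forall x, B x -> is_derive x 1 F (f x)) ->
  (\int[leb]_(x in `[a n, b n]) (f x)%:E = (F (b n) - F (a n))%:E)%E.
Proof.
move=> cf dF; rewrite EFinB; apply: continuous_FTC2 => //.
- by apply: continuous_in_subspaceT => x; rewrite inE => /sub xB; apply: cf; rewrite inE.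
- have cF x : B x -> {for x, continuous F}.
    by move=> /dF dFx; apply/differentiable_continuous/derivable1_diffP; exact: ex_derive.
  split.
  + by move=> x /subset_itv_oo_cc /sub /dF dFx; exact: ex_derive.
  + apply: cvg_at_right_filter; apply: cF; apply: (sub (n := n)).
    by rewrite in_itv /= lexx ltW.
  + apply: cvg_at_left_filter; apply: cF; apply: (sub (n := n)).
    by rewrite in_itv /= lexx ltW.
- by move=> x /subset_itv_oo_cc /sub /dF dFx; rewrite derive1E derive_val.
Qed.

(** By monotone convergence, the integral of |f| over B is the limit of those over
    the segments, each at most G(b n) - G(a n) <= 2 C. *)
Lemma integrable_of_primitive (f g G : R -> R) (C : R) :
  {in B, continuous f} -> {in B, continuous g} ->
  (forall x, B x -> `|f x| <= g x) ->
  (forall x, B x -> is_derive x 1 G (g x)) ->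
  (forall x, B x -> `|G x| <= C) ->
  leb.-integrable B (EFin \o f).
Proof.
move=> cf cg fg dG GC.
apply/integrableP; split.
  by apply/measurable_EFinP; exact: exhaustion_measurable_fun.
have mfn n : measurable_fun `[a n, b n] (fun x => `|f x|).
  apply: measurableT_comp => //.
  by apply: measurable_funS (exhaustion_measurable_fun cf) => // x; exact: sub.
have mgn n : measurable_fun `[a n, b n] g.
  by apply: measurable_funS (exhaustion_measurable_fun cg) => // x; exact: sub.
have cvf : (\int[leb]_(x in `[a n, b n]) `|f x|%:E @[n --> \oo] -->
           \int[leb]_(x in B) `|f x|%:E)%E.
  rewrite cover_ab; apply: ge0_nondecreasing_set_cvg_integral => //.
  by move=> n; apply/measurable_EFinP; exact: mfn.
apply: (@le_lt_trans _ _ (2 * C)%:E); last by rewrite ltry.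
rewrite -(cvg_lim _ cvf) //; apply: lime_le; first by apply/cvg_ex; eexists; exact: cvf.
apply: nearW => n.
apply: (@le_trans _ _ (\int[leb]_(x in `[a n, b n]) (g x)%:E)%E).
  apply: ge0_le_integral => //.
  - by apply/measurable_EFinP; exact: mfn.
  - by apply/measurable_EFinP; exact: mgn.
  - by move=> x /sub /fg; rewrite lee_fin.
rewrite (FTC2_itv _ cg dG) lee_fin.
have an : B (a n) by apply: (sub (n := n)); rewrite in_itv /= lexx ltW.
have bn : B (b n) by apply: (sub (n := n)); rewrite in_itv /= lexx ltW.
have := GC _ an; have := GC _ bn; rewrite !ler_norml => /andP[? ?] /andP[? ?]; lra.
Qed.

(** The integral over the segment is F(b n) - F(a n); it tends to 0, and by dominated
    convergence to the integral over B. *)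
Lemma integral_derivative_eq0 (f F : R -> R) :
  {in B, continuous f} -> leb.-integrable B (EFin \o f) ->
  (forall x, B x -> is_derive x 1 F (f x)) ->
  F (a n) @[n --> \oo] --> 0 -> F (b n) @[n --> \oo] --> 0 ->
  (\int[leb]_(x in B) (f x)%:E = 0)%E.
Proof.
move=> cf If dF Fa Fb.
have cvf : (\int[leb]_(x in `[a n, b n]) (f x)%:E @[n --> \oo] -->
           \int[leb]_(x in B) (f x)%:E)%E.
  under eq_cvg do rewrite integral_mkcond.
  pose h := ((EFin \o f) \_ B)%E.
  have -> : (\int[leb]_(x in B) (f x)%:E = \int[leb]_x h x)%E by rewrite /h integral_mkcond.
  have mh : measurable_fun setT h.
    apply: (measurable_restrictT (EFin \o f) mB).1; apply/measurable_EFinP; exact: exhaustion_measurable_fun.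
  have [] := @dominated_convergence _ _ _ leb setT measurableT
     (fun n => (EFin \o f) \_ `[a n, b n]%classic) h (fun x => `|h x|%E) => //.
  - move=> n; apply: (measurable_restrictT (EFin \o f) (measurable_itv _)).1.
    apply: (@measurable_funS _ _ _ _ B) => //; first by move=> x; exact: sub.
    by apply/measurable_EFinP; exact: exhaustion_measurable_fun.
  - apply: aeW => x _; rewrite /h patchE; case: ifPn => [|xB].
      rewrite inE {1}cover_ab => -[N _ xN].
      apply: cvg_near_cst; exists N => // n Nn; rewrite patchE mem_set //.
      by move/subsetPset : (nd_itv Nn); apply.
    apply: cvg_near_cst; apply: nearW => n; rewrite patchE memNset // => /sub Bx.
    by rewrite mem_set in xB.
  - by apply: integrable_abse; apply/integrable_restrict => //; rewrite setTI.
  - apply: aeW => x n _; rewrite /h !patchE; case: ifPn => [|_]; last by rewrite abse0 abse_ge0.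
    by rewrite inE => /sub xB; rewrite mem_set.
have <- : limn (fun n => \int[leb]_(x in `[a n, b n]) (f x)%:E)%E = 0%E.
  apply/cvg_lim => //; under eq_cvg do rewrite (FTC2_itv _ cf dF).
  apply: cvg_EFin; first exact: nearW.
  by rewrite -[0](subr0 (0 : R)); exact: cvgB.
by apply/esym/cvg_lim.
Qed.

End Exhaustion.

(** * Moments of a Pearson weight *)

Section PearsonWeight.
Variable R : realType.
Local Notation leb := (@lebesgue_measure R).
Variables (B : set R) (a b : nat -> R) (w dw : R -> R) (p0 p1 p2 q0 q1 : R).
Hypothesis ab : forall n, a n < b n.
Hypothesis nd_ab : forall n m, (n <= m)%N -> a m <= a n /\ b n <= b m.
Hypothesis cover_ab : B = \bigcup_n `[a n, b n]%classic.
Hypothesis w_gt0 : forall x, B x -> 0 < w x.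
Hypothesis dw_w : forall x, B x -> is_derive x 1 w (dw x).
Hypothesis pearson_eq : forall x, B x ->
  (p0 + p1 * x + p2 * x ^+ 2) * dw x = (q0 + q1 * x) * w x.
Hypothesis moment_integrable : forall k, leb.-integrable B (fun x => (x ^+ k * w x)%:E).
Let F k x := (p0 + p1 * x + p2 * x ^+ 2) * x ^+ k * w x.
Hypothesis F_cvg_a : forall k, F k (a n) @[n --> \oo] --> 0.
Hypothesis F_cvg_b : forall k, F k (b n) @[n --> \oo] --> 0.

Let M k := fine (\int[leb]_(x in B) (x ^+ k * w x)%:E).

Let mB : measurable B.
Proof. by rewrite cover_ab; apply: bigcupT_measurable => n; exact: measurable_itv. Qed.

Let ME k : (\int[leb]_(x in B) (x ^+ k * w x)%:E = (M k)%:E)%E.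
Proof. by rewrite /M fineK // integrable_fin_num. Qed.

Let cw : {in B, continuous w}.
Proof.
move=> x; rewrite inE => /dw_w dwx.
by apply/differentiable_continuous/derivable1_diffP; exact: ex_derive.
Qed.

(** The integral over B of the derivative of p x^k w is zero. *)
Lemma pearson_moment_recurrence k :
  k%:R * p0 * M k.-1 + (q0 + k.+1%:R * p1) * M k + (q1 + k.+2%:R * p2) * M k.+1 = 0.
Proof.
pose c1 := k%:R * p0; pose c2 := q0 + k.+1%:R * p1; pose c3 := q1 + k.+2%:R * p2.
pose f x := c1 * (x ^+ k.-1 * w x) + (c2 * (x ^+ k * w x) + c3 * (x ^+ k.+1 * w x)).
have Ic (c : R) j : leb.-integrable B (fun x => (c * (x ^+ j * w x))%:E).
  by apply: (@integrableZl _ _ _ leb B mB c (fun x => (x ^+ j * w x)%:E)).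
have I23 : leb.-integrable B (fun x => (c2 * (x ^+ k * w x) + c3 * (x ^+ k.+1 * w x))%:E).
  exact: (@integrableD _ _ _ leb B mB (fun x => (c2 * (x ^+ k * w x))%:E)
    (fun x => (c3 * (x ^+ k.+1 * w x))%:E) (Ic c2 k) (Ic c3 k.+1)).
have If : leb.-integrable B (EFin \o f).
  exact: (@integrableD _ _ _ leb B mB (fun x => (c1 * (x ^+ k.-1 * w x))%:E)
    (fun x => (c2 * (x ^+ k * w x) + c3 * (x ^+ k.+1 * w x))%:E) (Ic c1 k.-1) I23).
have cf : {in B, continuous f}.
  move=> x xB; rewrite /f.
  have cm (c : R) (j : nat) : {for x, continuous (fun y : R => c * (y ^+ j * w y))}.
    apply: cvgM; first exact: cvg_cst.
    by apply: cvgM; [exact: exprn_continuous|exact: cw].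
  by apply: cvgD; [exact: cm|apply: cvgD; exact: cm].
have dF x : B x -> is_derive x 1 (F k) (f x).
  move=> xB; have dwx := dw_w xB.
  pose P : {poly R} := (p0%:P + p1 *: 'X + p2 *: 'X^2) * 'X^k.
  have -> : F k = horner P * w by apply/funext => y; rewrite /F /P !fctE !hornerE.
  apply: (is_derive_eq (is_deriveM (is_derive_poly P x) dwx)).
  rewrite /GRing.scale /= /P !poly.derivE !hornerE hornerMn hornerXn.
  rewrite /f /c1 /c2 /c3 /=.
  have E := pearson_eq xB; rewrite expr2 in E.
  rewrite -[p2 * x * x]mulrA mulrAC E -[_ *+ k]mulr_natl.
  clear; case: k => [|k] /=; first by rewrite !expr0; ring.
  by rewrite !exprS; ring.
have := integral_derivative_eq0 ab nd_ab cover_ab cf If dF (F_cvg_a k) (F_cvg_b k).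
rewrite /f; under eq_integral do rewrite EFinD.
rewrite integralD //.
under [X in (_ + X)%E = _ -> _]eq_integral do rewrite EFinD.
rewrite integralD //.
under eq_integral do rewrite EFinM.
under [X in (_ + (X + _))%E = _ -> _]eq_integral do rewrite EFinM.
under [X in (_ + (_ + X))%E = _ -> _]eq_integral do rewrite EFinM.
rewrite !integralZl // !ME -!EFinM -!EFinD => -[].
by rewrite addrA.
Qed.

(** Otherwise w would vanish almost everywhere on a segment of positive length,
    where it is positive. *)
Lemma pearson_moment0_neq0 : M 0 != 0.
Proof.
apply/eqP => M0.
have : (\int[leb]_(x in B) `|(w x)%:E| = 0)%E.
  transitivity (\int[leb]_(x in B) (x ^+ 0 * w x)%:E)%E; last by rewrite ME M0.
  apply: eq_integral => x; rewrite inE => xB.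
  by rewrite abse_EFin expr0 mul1r gtr0_norm // w_gt0.
have mw : measurable_fun B (fun x => (w x)%:E).
  by apply/measurable_EFinP; exact: (exhaustion_measurable_fun cover_ab cw).
move=> w_int0; have [N [mN N0 BN]] := (ae_eq_integral_abs leb mB mw).1 w_int0.
have abN : `[a 0%N, b 0%N]%classic `<=` N.
  move=> x xab; apply: BN => /= h.
  have xB : B x by rewrite cover_ab; exists 0%N.
  have [w0] := h xB; by have := w_gt0 xB; rewrite w0 ltxx.
have : (leb `[a 0%N, b 0%N]%classic <= 0)%E by rewrite -N0; apply: le_measure => //; rewrite inE.
by rewrite lebesgue_measure_itv /= lte_fin ab -EFinD lee_fin leNgt subr_gt0 ab.
Qed.

Lemma pearson_moments : exists (nu : {finite_measure set (measurableTypeR R) -> \bar R})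
    (m : nat -> R),
  [/\ forall k, nu.-integrable setT (fun x => (x ^+ k)%:E),
      forall k, (\int[nu]_x (x ^+ k)%:E = (m k)%:E)%E,
      m 0%N != 0 &
      forall k, k%:R * p0 * m k.-1 + (q0 + k.+1%:R * p1) * m k +
        (q1 + k.+2%:R * p2) * m k.+1 = 0].
Proof.
pose W := w \_ B.
have EW (f : R -> R) : (fun x => (f x * W x)%:E) = (fun x => (f x * w x)%:E) \_ B.
  by apply/funext => x; rewrite /W !patchE; case: ifP => // _; rewrite mulr0.
have IW (f : R -> R) : leb.-integrable B (fun x => (f x * w x)%:E) ->
    leb.-integrable setT (fun x => (f x * W x)%:E).
  by rewrite EW => ifw; exact: (@integrable_mkcond _ (measurableTypeR R) R leb B (fun x => (f x * w x)%:E) mB).1 ifw.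
have [||| nu nuP] := @density_measure R W.
- apply: (measurable_restrictT w mB).1; exact: (exhaustion_measurable_fun cover_ab cw).
- by move=> x; rewrite /W patchE; case: ifP => //; rewrite inE => /w_gt0/ltW.
- have := IW _ (moment_integrable 0); under eq_fun do rewrite expr0 mul1r.
  by [].
exists nu, M; split.
- move=> k; apply: (nuP (fun x => x ^+ k) _ _).1 => //.
  exact: (IW (fun x => x ^+ k)).
- move=> k; rewrite (nuP (fun x => x ^+ k) _ _).2 //; last exact: (IW (fun x => x ^+ k)).
  by rewrite (EW (fun x => x ^+ k)) -integral_mkcond ME.
- exact: pearson_moment0_neq0.
- exact: pearson_moment_recurrence.
Qed.
End PearsonWeight.

(** * Weights given by the exponential of a function *)

Section WeightTools.
Variable R : realType.

Lemma cvg0_squeeze (u v : nat -> R) (C : R) :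
  (forall n, `|u n| <= C * v n) -> v n @[n --> \oo] --> 0 -> u n @[n --> \oo] --> 0.
Proof.
move=> uv v0; apply: norm_cvg0; apply: (@squeeze_cvgr _ _ _ _ (fun=> 0) (fun n => C * v n)).
- by apply: nearW => n; rewrite normr_ge0 uv.
- exact: cvg_cst.
- by rewrite -(mulr0 C); apply: cvgM => //; exact: cvg_cst.
Qed.

Lemma powR_inv_cvg0 (s : R) : 0 < s -> expR (s * ln (n.+2%:R^-1)) @[n --> \oo] --> 0.
Proof.
move=> s0.
have -> : (fun n => expR (s * ln (n.+2%:R^-1))) = (fun n => (n.+2%:R^-1 : R) `^ s).
  by apply/funext => n; rewrite /powR invr_eq0 pnatr_eq0.
have := powR_cvg0 s0 => /cvg_at_rightP /(_ (fun n => n.+2%:R^-1)).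
by apply; split=> //; rewrite (cvg_shiftS (@harmonic R)); exact: cvg_harmonic.
Qed.

(** The graph of t ln lies below its tangent at t, which has slope 1. *)
Lemma mul_ln_le (t : R) : 0 < t -> exists c : R, forall y, 0 < y -> t * ln y <= y + c.
Proof.
move=> t0; exists (t * ln t - t) => y y0.
have : ln (y / t) <= y / t - 1.
  have := @le_ln1Dx R (y / t - 1); rewrite [1 + _]addrC subrK; apply.
  by rewrite ltrBDl subrr divr_gt0.
rewrite ln_div ?posrE // => /(ler_wpM2l (ltW t0)).
have -> : t * (y / t - 1) = y - t by field; rewrite gt_eqF.
by rewrite mulrBr; lra.
Qed.

Lemma is_derive_continuous_in (B : set R) (f df : R -> R) :
  (forall x, B x -> is_derive x 1 f (df x)) -> {in B, continuous f}.
Proof.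
move=> fB x; rewrite inE => /fB dfx.
by apply/differentiable_continuous/derivable1_diffP; exact: ex_derive.
Qed.

Lemma is_derive_expR_comp (h : R -> R) (x dh : R) :
  is_derive x 1 h dh -> is_derive x 1 (fun y => expR (h y)) (expR (h x) * dh).
Proof. by move=> dhx; exact: is_derive1_comp. Qed.

Lemma is_derive_ln1D (x : R) : -1 < x -> is_derive x 1 (fun y => ln (1 + y)) (1 + x)^-1.
Proof.
move=> x1; have x0 : 0 < (cst 1 + id : R -> R) x by rewrite fctE /= -ltrBlDl sub0r.
have D : is_derive x 1 (cst 1 + id : R -> R) (0 + 1) by exact: is_deriveD.
have := is_derive1_comp (is_derive1_ln x0) D.
by rewrite add0r mulr1.
Qed.

Lemma is_derive_ln1B (x : R) : x < 1 -> is_derive x 1 (fun y => ln (1 - y)) (- (1 - x)^-1).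
Proof.
move=> x1; have x0 : 0 < (cst 1 - id : R -> R) x by rewrite fctE /= subr_gt0.
have D : is_derive x 1 (cst 1 - id : R -> R) (0 - 1) by exact: is_deriveB.
have := is_derive1_comp (is_derive1_ln x0) D.
by rewrite sub0r mulrN1.
Qed.

Lemma is_derive_lin (f g : R -> R) (a b x df dg : R) :
  is_derive x 1 f df -> is_derive x 1 g dg ->
  is_derive x 1 (fun y => a * f y + b * g y) (a * df + b * dg).
Proof.
by move=> dfx dgx; exact: (is_deriveD (is_deriveZ a dfx) (is_deriveZ b dgx)).
Qed.

(** What the rest of the proof needs to know of a one-variable weight.  The
    condition on the leading coefficients is what lets monomials of positive
    degree be reduced modulo the image. *)
Record pearson_weight (B : set R) (w : R -> R) (p0 p1 p2 q0 q1 : R) : Prop := {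
  pw_open : open B;
  pw_unit_itv : forall x, 0 < x < 1 -> B x;
  pw_gt0 : forall x, B x -> 0 < w x;
  pw_derive : forall x, B x -> exists2 dw, is_derive x 1 w dw &
    (p0 + p1 * x + p2 * x ^+ 2) * dw = (q0 + q1 * x) * w x;
  pw_leading : forall k, q1 + k.+2%:R * p2 != 0;
  pw_moments : exists (nu : {finite_measure set (measurableTypeR R) -> \bar R}) (m : nat -> R),
    [/\ forall k, nu.-integrable setT (fun x => (x ^+ k)%:E),
      forall k, (\int[nu]_x (x ^+ k)%:E = (m k)%:E)%E,
      m 0%N != 0 &
      forall k, k%:R * p0 * m k.-1 + (q0 + k.+1%:R * p1) * m k +
        (q1 + k.+2%:R * p2) * m k.+1 = 0] }.

Lemma pearson_weight_eq (B : set R) (w W : R -> R) (p0 p1 p2 q0 q1 : R) :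
  {in B, w =1 W} -> pearson_weight B W p0 p1 p2 q0 q1 -> pearson_weight B w p0 p1 p2 q0 q1.
Proof.
move=> wW [oB uB W0 dW lead mom]; split=> //.
  by move=> x xB; rewrite wW ?inE //; exact: W0.
move=> x xB; have [dw dWx e] := dW x xB; exists dw; last by rewrite wW ?inE.
apply: near_eq_is_derive dWx; have : nbhs x B by exact: open_nbhs_nbhs.
by apply: filterS => y yB; rewrite wW ?inE.
Qed.

(** Writing the weight as expR h turns the Pearson equation into p h' = q, and
    keeps real powers out of the computations.  Each x^k w needs a dominating
    function g with a bounded primitive G. *)
Lemma exp_pearson_weight (B : set R) (a b : nat -> R) (h dh : R -> R) (p0 p1 p2 q0 q1 : R) :
  open B -> (forall x, 0 < x < 1 -> B x) ->
  (forall n, a n < b n) ->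
  (forall n m, (n <= m)%N -> a m <= a n /\ b n <= b m) ->
  B = \bigcup_n `[a n, b n]%classic ->
  (forall x, B x -> is_derive x 1 h (dh x)) ->
  (forall x, B x -> (p0 + p1 * x + p2 * x ^+ 2) * dh x = q0 + q1 * x) ->
  (forall k, q1 + k.+2%:R * p2 != 0) ->
  (forall k : nat, exists g : R -> R, exists G : R -> R, exists C : R,
     [/\ {in B, continuous g}, forall x, B x -> is_derive x 1 G (g x),
         forall x, B x -> `|G x| <= C &
         forall x, B x -> `|x ^+ k * expR (h x)| <= g x]) ->
  (forall k, (p0 + p1 * a n + p2 * a n ^+ 2) * a n ^+ k * expR (h (a n)) @[n --> \oo] --> 0) ->
  (forall k, (p0 + p1 * b n + p2 * b n ^+ 2) * b n ^+ k * expR (h (b n)) @[n --> \oo] --> 0) ->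
  pearson_weight B (fun x => expR (h x)) p0 p1 p2 q0 q1.
Proof.
move=> oB uB ab nd_ab cover dhB eqB lead bound Fa Fb.
have dW x : B x -> is_derive x 1 (fun y => expR (h y)) (expR (h x) * dh x).
  by move=> /dhB; exact: is_derive_expR_comp.
have eqW x : B x -> (p0 + p1 * x + p2 * x ^+ 2) * (expR (h x) * dh x) =
    (q0 + q1 * x) * expR (h x).
  by move=> xB; rewrite -eqB // mulrCA mulrC mulrA.
split=> //.
- by move=> x _; exact: expR_gt0.
- by move=> x xB; exists (expR (h x) * dh x); [exact: dW|exact: eqW].
- apply: (pearson_moments ab nd_ab cover (w := fun x => expR (h x)) _ dW eqW _ Fa Fb).
    by move=> x _; exact: expR_gt0.
  move=> k; have [g [G [C [cg dG GC fg]]]] := bound k.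
  apply: (integrable_of_primitive ab nd_ab cover _ cg fg dG GC).
  move=> x xB; apply: cvgM; first exact: exprn_continuous.
  exact: (is_derive_continuous_in dW).
Qed.

End WeightTools.

(** * The Hermite weight *)

Section Hermite.
Variable R : realType.

Let h (x : R) := - x ^+ 2.

(** The dominating function is a multiple of the derivative of atan, since
    (1 + x^2)^(k + 1) is at most a constant times exp (1 + x^2). *)
Let hermite_bound k : exists C : R, forall x, `|x ^+ k * expR (h x)| <= C * (1 + x ^+ 2)^-1.
Proof.
have [c cP] := @mul_ln_le R k.+1%:R (ltr0Sn _ _).
exists (expR (1 + c)) => x; set y := 1 + x ^+ 2.
have y0 : 0 < y by rewrite ltr_wpDr ?sqr_ge0.
rewrite ler_pdivlMr // normrM (ger0_norm (expR_ge0 _)) normrX.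
have xy : `|x| <= y.
  by rewrite /y -real_normK ?num_real //; have := sqr_ge0 (`|x| - 1); have := normr_ge0 x; nra.
apply: (@le_trans _ _ (y ^+ k * expR (h x) * y)).
  by rewrite ler_pM2r // ler_pM2r ?expR_gt0 // lerXn2r ?nnegrE // ltW.
have -> : y ^+ k * expR (h x) * y = expR (k.+1%:R * ln y + h x).
  by rewrite expRD expRM_natl lnK ?posrE // exprS; ring.
by rewrite ler_expR; have := cP y y0; rewrite /h /y; lra.
Qed.

Lemma hermite_pearson_weight :
  pearson_weight [set: R] (fun x => expR (h x)) 1 0 0 0 (-2).
Proof.
have Fcvg (u : nat -> R) (k : nat) : (forall n, `|u n| = n.+1%:R) ->
    (1 + 0 * u n + 0 * u n ^+ 2) * u n ^+ k * expR (h (u n)) @[n --> \oo] --> 0.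
  move=> un; have [C CP] := hermite_bound k.
  apply: (@cvg0_squeeze _ _ (fun n => n.+1%:R^-1) C); last exact: cvg_harmonic.
  move=> n; rewrite !mul0r !addr0 mul1r; apply: le_trans (CP _) _.
  have C0 : 0 <= C.
    have := CP 0; rewrite [0 ^+ 2]expr0n /= addr0 invr1 mulr1; exact: le_trans.
  apply: ler_wpM2l => //; rewrite lef_pV2 ?posrE ?ltr0Sn //; last first.
    by rewrite ltr_wpDr ?sqr_ge0.
  rewrite -(real_normK (num_real (u n))) un.
  by have := ler0n R n; rewrite -natr1; nra.
apply: (@exp_pearson_weight _ _ (fun n => - n.+1%:R) (fun n => n.+1%:R) h (fun x => -2 * x)) => //.
- exact: openT.
- by move=> n; rewrite gtrN // ltr0Sn.
- by move=> n m nm; rewrite lerN2 ler_nat ltnS nm.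
- apply/seteqP; split => // x _; exists (Num.truncn `|x|) => //=.
  by rewrite in_itv /= -ler_norml ltW // truncnS_gt.
- move=> x _; have := is_deriveN (is_deriveX 2 (is_derive_id x (1:R))).
  by move=> D; apply: is_derive_eq D _; rewrite /GRing.scale /=; ring.
- by move=> x _; ring.
- move=> k; have [C CP] := hermite_bound k.
  exists (fun x => C * (1 + x ^+ 2)^-1), (fun x => C * atan x), (`|C| * pi); split=> // x _.
  + apply: cvgM; first exact: cvg_cst.
    apply: cvgV; first by rewrite gt_eqF // ltr_wpDr ?sqr_ge0.
    by apply: cvgD; [exact: cvg_cst|exact: exprn_continuous].
  + exact: (is_deriveZ C (is_derive1_atan x)).
  + rewrite normrM ler_wpM2l // ler_norml.
    have := atan_gtNpi2 x; have := atan_ltpi2 x; have := pi_ge0 R; lra.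
- by move=> k; apply: Fcvg => n; rewrite normrN normr_nat.
- by move=> k; apply: Fcvg => n; rewrite normr_nat.
Qed.
End Hermite.

(** * The Laguerre weight *)

Section Laguerre.
Variables (R : realType) (alpha : R).
Hypothesis alphaN1 : -1 < alpha.

Let h (x : R) := alpha * ln x + (-1) * x.
(** The logarithm of (x / (1 + x))^(s + 1), s = alpha + k.  This power is bounded,
    and its derivative, proportional to x^s (1 + x)^(-s-2), behaves like x^s near 0
    and still dominates x^s e^(-x) at infinity. *)
Let u (k : nat) (x : R) := (alpha + k%:R + 1) * ln x + - (alpha + k%:R + 1) * ln (1 + x).

Let s_gt0 (k : nat) : 0 < alpha + k%:R + 1.
Proof. by move: alphaN1 (ler0n R k); lra. Qed.

Let u_le0 (k : nat) (x : R) : 0 < x -> u k x <= 0.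
Proof.
move=> x0; rewrite /u mulNr -mulrBr pmulr_rle0 // subr_le0 ler_ln ?posrE //; lra.
Qed.

Let laguerre_bound (k : nat) : exists2 C : R, 0 <= C & forall x : R, 0 < x ->
  `|x ^+ k * expR (h x)| <= C * (expR (u k x) / (x * (1 + x))).
Proof.
have [|c cP] := @mul_ln_le R (alpha + k%:R + 2); first by have := s_gt0 k; lra.
exists (expR (1 + c)) => [|x x0]; first exact: expR_ge0.
have x10 : 0 < 1 + x by lra.
rewrite ger0_norm ?mulr_ge0 ?exprn_ge0 ?expR_ge0 ?(ltW x0) // mulrA ler_pdivlMr ?mulr_gt0 //.
have -> : x ^+ k * expR (h x) * (x * (1 + x)) =
    expR (k%:R * ln x + h x + ln x + ln (1 + x)).
  by rewrite !expRD expRM_natl !lnK ?posrE //; ring.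
rewrite -expRD ler_expR; have := cP _ x10; rewrite /h /u; lra.
Qed.

Let is_derive_u (k : nat) (x : R) : 0 < x ->
  is_derive x 1 (u k) ((alpha + k%:R + 1) * x^-1 + - (alpha + k%:R + 1) * (1 + x)^-1).
Proof.
move=> x0; apply: is_derive_lin; first exact: is_derive1_ln.
by apply: is_derive_ln1D; lra.
Qed.

Lemma laguerre_pearson_weight :
  pearson_weight `]0, +oo[%classic (fun x => expR (h x)) 0 1 0 alpha (-1).
Proof.
have Bpos (x : R) : x \in `]0, +oo[ -> 0 < x by rewrite in_itv /= andbT.
apply: (@exp_pearson_weight _ _ (fun n => n.+2%:R^-1) (fun n => n.+1%:R) h
  (fun x => alpha * x^-1 + (-1) * 1)).
- exact: interval_open.
- by move=> x /andP[x0 _] /=; rewrite in_itv /= x0.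
- move=> n; apply: (@lt_le_trans _ _ 1); last by rewrite ler1n.
  by rewrite invf_lt1 ?ltr1n ?ltr0n.
- by move=> n m nm; rewrite lef_pV2 ?posrE ?ltr0n // !ler_nat !ltnS nm.
- apply/seteqP; split => x /=; last first.
    move=> [n _ /=]; rewrite !in_itv /= andbT => /andP[+ _].
    by apply: lt_le_trans; rewrite invr_gt0 ltr0n.
  move=> /Bpos x0; exists (maxn (Num.truncn x) (Num.truncn x^-1)) => //=.
  rewrite in_itv /=; apply/andP; split.
    rewrite -[leRHS]invrK lef_pV2 ?posrE ?invr_gt0 ?ltr0n //.
    apply: ltW; apply: lt_le_trans (truncnS_gt _) _.
    by rewrite ler_nat ltnS (leq_trans (leq_maxr _ _) (leqnSn _)).
  apply: ltW; apply: lt_le_trans (truncnS_gt _) _.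
  by rewrite ler_nat ltnS leq_maxl.
- by move=> x /Bpos x0; apply: is_derive_lin => //; exact: is_derive1_ln.
- by move=> x /Bpos x0; field; rewrite gt_eqF.
- by move=> k; rewrite mulr0 addr0 oppr_eq0 oner_eq0.
- move=> k; have [C C0 CP] := laguerre_bound k.
  pose s := alpha + k%:R + 1; pose D := C / s.
  exists (fun x => D * (expR (u k x) * (s * x^-1 + - s * (1 + x)^-1))),
    (fun x => D * expR (u k x)), D; split.
  + move=> x; rewrite inE => /Bpos x0.
    apply: cvgM; first exact: cvg_cst.
    apply: cvgM.
      apply: (@is_derive_continuous_in _ `]0, +oo[%classic
        (fun x => expR (u k x)) (fun x => expR (u k x) * (s * x^-1 + - s * (1 + x)^-1))).
        by move=> y /Bpos y0; apply: is_derive_expR_comp; exact: is_derive_u.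
      by rewrite inE /= in_itv /= x0.
    apply: cvgD; (apply: cvgM; [exact: cvg_cst|apply: cvgV]).
    * by rewrite gt_eqF.
    * exact: cvg_id.
    * by rewrite gt_eqF // addr_gt0.
    * by apply: cvgD; [exact: cvg_cst|exact: cvg_id].
  + move=> x /Bpos x0.
    apply: (is_deriveZ D); apply: is_derive_expR_comp; exact: is_derive_u.
  + move=> x /Bpos x0.
    have D0 : 0 <= D by rewrite divr_ge0 // ltW // s_gt0.
    rewrite normrM (ger0_norm D0) (ger0_norm (expR_ge0 _)) ler_piMr //.
    by rewrite -expR0 ler_expR u_le0.
  + move=> x /Bpos x0; apply: le_trans (CP x x0) _.
    rewrite le_eqVlt; apply/orP; left; apply/eqP; rewrite /D.
    have := s_gt0 k; rewrite -/s => s0.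
    have x10 : 0 < 1 + x by rewrite addr_gt0.
    by field; rewrite (gt_eqF s0) (gt_eqF x0) (gt_eqF x10).
- move=> k; apply: (@cvg0_squeeze _ _ (fun n => expR ((alpha + 1) * ln (n.+2%:R^-1))) 1).
    move=> n; set x := _^-1; have x0 : 0 < x by rewrite invr_gt0 ltr0n.
    have x1 : x <= 1 by rewrite invf_le1 ?ler1n ?ltr0n.
    rewrite mul0r addr0 add0r mul1r mul1r.
    rewrite ger0_norm ?mulr_ge0 ?exprn_ge0 ?expR_ge0 ?(ltW x0) //.
    have -> : expR ((alpha + 1) * ln x) = x * expR (alpha * ln x).
      by rewrite mulrDl mul1r expRD lnK ?posrE // mulrC.
    rewrite /h expRD -mulrA.
    rewrite ler_pM2l // mulrCA ler_piMr ?expR_ge0 //.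
    rewrite mulr_ile1 ?exprn_ge0 ?expR_ge0 ?exprn_ile1 ?(ltW x0) //.
    by rewrite -[leRHS]expR0 ler_expR mulN1r oppr_le0 ltW.
  by apply: powR_inv_cvg0; move: alphaN1; lra.
- move=> k; have [C C0 CP] := laguerre_bound k.
  apply: (@cvg0_squeeze _ _ (fun n => n.+1%:R^-1) C); last exact: cvg_harmonic.
  move=> n; have := ltr0Sn R n; move: (n.+1%:R) => x x0.
  rewrite mul0r addr0 add0r mul1r -mulrA normrM (gtr0_norm x0).
  apply: le_trans (ler_wpM2l (ltW x0) (CP x x0)) _.
  have -> : x * (C * (expR (u k x) / (x * (1 + x)))) = C * (expR (u k x) / (1 + x)).
    have x10 : 0 < 1 + x by rewrite addr_gt0.
    by field; rewrite (gt_eqF x0) (gt_eqF x10).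
  apply: ler_wpM2l => //; rewrite ler_pdivrMr ?addr_gt0 // mulrDr mulr1 mulVf ?gt_eqF //.
  have : expR (u k x) <= 1 by rewrite -expR0 ler_expR u_le0.
  have : 0 <= x^-1 by rewrite invr_ge0 ltW.
  by move: (x^-1) => y; lra.
Qed.
End Laguerre.

(** * The Jacobi weight *)

Section Jacobi.
Variables (R : realType) (alpha beta : R).
Hypotheses (alphaN1 : -1 < alpha) (betaN1 : -1 < beta).

Let h (x : R) := alpha * ln (1 - x) + beta * ln (1 + x).
Let e1 (x : R) := expR ((alpha + 1) * ln (1 - x)).
Let e2 (x : R) := expR ((beta + 1) * ln (1 + x)).

Let a1_gt0 : 0 < alpha + 1. Proof. by move: alphaN1; lra. Qed.
Let b1_gt0 : 0 < beta + 1. Proof. by move: betaN1; lra. Qed.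

Let ln1D_le1 (x : R) : -1 < x < 1 -> ln (1 + x) <= 1.
Proof. by move=> /andP[x1 x2]; apply: le_trans (le_ln1Dx x1) _; exact: ltW. Qed.

Let ln1B_le1 (x : R) : -1 < x < 1 -> ln (1 - x) <= 1.
Proof. by move=> /andP[x1 x2]; apply: ln1D_le1; rewrite ltrN2 x2 ltrNl x1. Qed.

Let e1_le (x : R) : -1 < x < 1 -> e1 x <= expR (alpha + 1).
Proof. by move=> /ln1B_le1 l1; rewrite ler_expR ler_piMr // ltW. Qed.

Let e2_le (x : R) : -1 < x < 1 -> e2 x <= expR (beta + 1).
Proof. by move=> /ln1D_le1 l1; rewrite ler_expR ler_piMr // ltW. Qed.

Let mul_ln_le_norm (c y : R) : 1 <= y -> ln y <= 1 -> c * ln y <= `|c|.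
Proof.
move=> y1 ly; have l0 := ln_ge0 y1.
apply: le_trans (ler_norm _) _; rewrite normrM (ger0_norm l0).
by rewrite ler_piMr.
Qed.

(** On each half of the interval, one of the two factors of the weight is bounded
    by exp |alpha| or exp |beta|, because the logarithm in it lies between 0
    and 1.  Each of the two remaining powers has a bounded primitive. *)
Let jacobi_bound (k : nat) (x : R) : -1 < x < 1 ->
  `|x ^+ k * expR (h x)| <= expR (`|alpha| + `|beta|) *
     (expR (alpha * ln (1 - x)) + expR (beta * ln (1 + x))).
Proof.
move=> x11; have /andP[x1 x2] := x11.
have xk : `|x| ^+ k <= 1 by rewrite exprn_ile1 // ltW // ltr_norml x1.
rewrite normrM normrX (ger0_norm (expR_ge0 _)).
apply: (@le_trans _ _ (expR (h x))); first by rewrite ler_piMl // expR_ge0.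
have a0 := normr_ge0 alpha; have b0 := normr_ge0 beta.
have [x0|x0] := leP 0 x.
  apply: (@le_trans _ _ (expR (`|alpha| + `|beta|) * expR (alpha * ln (1 - x)))).
    rewrite -expRD ler_expR /h [leRHS]addrC lerD2l.
    apply: (@le_trans _ _ `|beta|); last by rewrite lerDr.
    by apply: mul_ln_le_norm; [rewrite lerDl|exact: ln1D_le1].
  by rewrite ler_pM2l ?expR_gt0 // lerDl expR_ge0.
apply: (@le_trans _ _ (expR (`|alpha| + `|beta|) * expR (beta * ln (1 + x)))).
  rewrite -expRD ler_expR /h lerD2r.
  apply: (@le_trans _ _ `|alpha|); last by rewrite lerDl.
  by apply: mul_ln_le_norm; [rewrite lerDl oppr_ge0 ltW|exact: ln1B_le1].
by rewrite ler_pM2l ?expR_gt0 // lerDr expR_ge0.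
Qed.

(** The factor 1 - x^2 raises both exponents by one, so that they are positive. *)
Let jacobi_boundary (k : nat) (x : R) : -1 < x < 1 ->
  `|(1 + 0 * x + (-1) * x ^+ 2) * x ^+ k * expR (h x)| <= e1 x * e2 x.
Proof.
move=> /andP[x1 x2].
have y1 : 0 < 1 - x by rewrite subr_gt0.
have y2 : 0 < 1 + x by rewrite -ltrBlDl sub0r.
have -> : e1 x * e2 x = (1 - x) * (1 + x) * expR (h x).
  by rewrite /e1 /e2 /h !mulrDl !mul1r !expRD !lnK ?posrE //; ring.
have -> : 1 + 0 * x + (-1) * x ^+ 2 = (1 - x) * (1 + x) by ring.
rewrite !normrM (gtr0_norm y1) (gtr0_norm y2) (ger0_norm (expR_ge0 _)) ler_wpM2r ?expR_ge0 //.
rewrite ler_piMr ?mulr_ge0 ?(ltW y1) ?(ltW y2) // normrX exprn_ile1 // ltW // ltr_norml x1.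
by [].
Qed.

Let is_derive_e1 (x : R) : x < 1 ->
  is_derive x 1 e1 (e1 x * ((alpha + 1) * - (1 - x)^-1)).
Proof.
move=> x1; apply: is_derive_expR_comp.
exact: (is_deriveZ (alpha + 1) (is_derive_ln1B x1)).
Qed.

Let is_derive_e2 (x : R) : -1 < x ->
  is_derive x 1 e2 (e2 x * ((beta + 1) * (1 + x)^-1)).
Proof.
move=> x1; apply: is_derive_expR_comp.
exact: (is_deriveZ (beta + 1) (is_derive_ln1D x1)).
Qed.

Lemma jacobi_pearson_weight :
  pearson_weight `]-1, 1[%classic (fun x => expR (h x)) 1 0 (-1) (beta - alpha) (- (alpha + beta)).
Proof.
have Bin (x : R) : x \in `]-1, 1[ -> -1 < x < 1 by rewrite in_itv.
have d0 n : 0 < n.+2%:R^-1 :> R by rewrite invr_gt0 ltr0n.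
have d2 n : n.+2%:R^-1 <= 2^-1 :> R by rewrite lef_pV2 ?posrE ?ltr0n // ler_nat.
apply: (@exp_pearson_weight _ _ (fun n => -1 + n.+2%:R^-1) (fun n => 1 - n.+2%:R^-1) h
  (fun x => alpha * - (1 - x)^-1 + beta * (1 + x)^-1)).
- exact: interval_open.
- by move=> x /andP[x0 x1] /=; rewrite in_itv /= x1 andbT (lt_trans _ x0) // ltrN10.
- by move=> n; move: (d0 n) (d2 n); move: (n.+2%:R^-1) => d; lra.
- move=> n m nm; have : m.+2%:R^-1 <= n.+2%:R^-1 :> R.
    by rewrite lef_pV2 ?posrE ?ltr0n // ler_nat !ltnS.
  by move: (m.+2%:R^-1) (n.+2%:R^-1) => d d'; split; lra.
- apply/seteqP; split => x /=; last first.
    move=> [n _ /=]; rewrite !in_itv /= => /andP[]; move: (d0 n); move: (n.+2%:R^-1) => d *.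
    by apply/andP; split; lra.
  move=> /Bin/andP[x1 x2].
  have y1 : 0 < 1 - x by rewrite subr_gt0.
  have y2 : 0 < 1 + x by rewrite -ltrBlDl sub0r.
  have small (y : R) n : 0 < y -> (Num.truncn y^-1 <= n)%N -> n.+2%:R^-1 <= y.
    move=> y0 yn; rewrite -[leRHS]invrK lef_pV2 ?posrE ?invr_gt0 ?ltr0n //.
    apply: ltW; apply: lt_le_trans (truncnS_gt _) _.
    by rewrite ler_nat ltnS (leq_trans yn).
  exists (maxn (Num.truncn (1 - x)^-1) (Num.truncn (1 + x)^-1)) => //=.
  have := small _ _ y1 (leq_maxl _ (Num.truncn (1 + x)^-1)).
  have := small _ _ y2 (leq_maxr (Num.truncn (1 - x)^-1) _).
  rewrite in_itv /=; move: (_ %:R^-1) => d ? ?; apply/andP; split; lra.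
- move=> x /Bin/andP[x1 x2]; apply: is_derive_lin; first exact: is_derive_ln1B.
  exact: is_derive_ln1D.
- move=> x /Bin/andP[x1 x2].
  have y1 : 0 < 1 - x by rewrite subr_gt0.
  have y2 : 0 < 1 + x by rewrite -ltrBlDl sub0r.
  by field; rewrite (gt_eqF y1) (gt_eqF y2).
- move=> k; rewrite lt_eqF //; move: a1_gt0 b1_gt0 (ler0n R k).
  by rewrite -natr1 -[k.+1%:R]natr1; lra.
- move=> k; pose C := expR (`|alpha| + `|beta|).
  pose D1 := - (C / (alpha + 1)); pose D2 := C / (beta + 1).
  exists (fun x => D1 * (e1 x * ((alpha + 1) * - (1 - x)^-1)) +
                   D2 * (e2 x * ((beta + 1) * (1 + x)^-1))),
    (fun x => D1 * e1 x + D2 * e2 x),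
    (`|D1| * expR (alpha + 1) + `|D2| * expR (beta + 1)); split.
  + move=> x; rewrite inE => /Bin/andP[x1 x2].
    have y1 : 0 < 1 - x by rewrite subr_gt0.
    have y2 : 0 < 1 + x by rewrite -ltrBlDl sub0r.
    have c1 : {for x, continuous e1}.
      by apply/differentiable_continuous/derivable1_diffP; have := is_derive_e1 x2 => ?; exact: ex_derive.
    have c2 : {for x, continuous e2}.
      by apply/differentiable_continuous/derivable1_diffP; have := is_derive_e2 x1 => ?; exact: ex_derive.
    apply: cvgD; (apply: cvgM; first exact: cvg_cst); (apply: cvgM => //); (apply: cvgM; first exact: cvg_cst).
      apply: cvgN; apply: cvgV; first by rewrite gt_eqF.
      by apply: cvgB; [exact: cvg_cst|exact: cvg_id].
    apply: cvgV; first by rewrite gt_eqF.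
    by apply: cvgD; [exact: cvg_cst|exact: cvg_id].
  + move=> x /Bin/andP[x1 x2].
    by apply: is_derive_lin; [exact: is_derive_e1|exact: is_derive_e2].
  + move=> x /Bin x11; apply: le_trans (ler_normD _ _) _; rewrite !normrM.
    by apply: lerD; (apply: ler_wpM2l => //); rewrite (ger0_norm (expR_ge0 _));
      [exact: e1_le|exact: e2_le].
  + move=> x /Bin x11; apply: le_trans (jacobi_bound k x11) _; have /andP[x1 x2] := x11.
    have y1 : 0 < 1 - x by rewrite subr_gt0.
    have y2 : 0 < 1 + x by rewrite -ltrBlDl sub0r.
    rewrite le_eqVlt; apply/orP; left; apply/eqP; rewrite -/C /D1 /D2.
    have -> : e1 x = (1 - x) * expR (alpha * ln (1 - x)).
      by rewrite /e1 mulrDl mul1r expRD lnK ?posrE // mulrC.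
    have -> : e2 x = (1 + x) * expR (beta * ln (1 + x)).
      by rewrite /e2 mulrDl mul1r expRD lnK ?posrE // mulrC.
    by field; rewrite (gt_eqF y1) (gt_eqF y2) (gt_eqF a1_gt0) (gt_eqF b1_gt0).
- move=> k; apply: (@cvg0_squeeze _ _ (fun n => expR ((beta + 1) * ln (n.+2%:R^-1)))
    (expR (alpha + 1))); last exact: powR_inv_cvg0.
  move=> n; have x11 : -1 < -1 + (n.+2%:R^-1 : R) < 1.
    by move: (d0 n) (d2 n); move: (n.+2%:R^-1) => d *; apply/andP; split; lra.
  apply: le_trans (jacobi_boundary k x11) _.
  rewrite [e2 _]/e2 addrA subrr add0r ler_wpM2r ?expR_ge0 //; exact: e1_le.
- move=> k; apply: (@cvg0_squeeze _ _ (fun n => expR ((alpha + 1) * ln (n.+2%:R^-1)))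
    (expR (beta + 1))); last exact: powR_inv_cvg0.
  move=> n; have x11 : -1 < 1 - (n.+2%:R^-1 : R) < 1.
    by move: (d0 n) (d2 n); move: (n.+2%:R^-1) => d *; apply/andP; split; lra.
  apply: le_trans (jacobi_boundary k x11) _.
  rewrite [e1 _]/e1 opprB [1 + (_ - _)]addrC subrK mulrC ler_wpM2r ?expR_ge0 //; exact: e2_le.
Qed.
End Jacobi.

(** * The classical pairs *)

Section ClassicalPairs.
Variable R : realType.
Implicit Types (B : set R) (w : R -> R).

Definition nondegenerate (p0 p1 p2 q0 q1 : R) : Prop :=
  exists c : R, exists rs : seq R, [/\ c != 0, uniq rs,
    forall t, p0 + p1 * t + p2 * t ^+ 2 = c * \prod_(r <- rs) (t - r) &
    forall r, r \in rs -> q0 + q1 * r != 0].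

(** After cancellation of a common root of p and q, the logarithmic derivative of w is
    b0 / (a0 + a1 x). *)
Definition degenerate B w : Prop :=
  exists a0 a1 b0 : R,
    (forall x dw, B x -> is_derive x 1 w dw -> (a0 + a1 * x) * dw = b0 * w x) /\
    forall k : nat, b0 + k.+1%:R * a1 != 0.

Definition pearson_pair B w (P : R * R * R * R * R) : Prop :=
  let: (p0, p1, p2, q0, q1) := P in
  pearson_weight B w p0 p1 p2 q0 q1 /\ (nondegenerate p0 p1 p2 q0 q1 \/ degenerate B w).

Lemma pearson_weight_derive B w p0 p1 p2 q0 q1 x dw :
  pearson_weight B w p0 p1 p2 q0 q1 -> B x -> is_derive x 1 w dw ->
  (p0 + p1 * x + p2 * x ^+ 2) * dw = (q0 + q1 * x) * w x.
Proof.
move=> [_ _ _ dW _ _] xB [_ <-]; have [dw' [_ <-]] := dW x xB.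
by [].
Qed.

Lemma hermite_pair_pearson B w : hermite_pair B w -> exists P, pearson_pair B w P.
Proof.
move=> [-> ww]; exists (1, 0, 0, 0, -2); split.
  exact: pearson_weight_eq ww (hermite_pearson_weight R).
left; exists 1, [::]; split=> // t.
by rewrite big_nil; ring.
Qed.

Lemma laguerre_pair_pearson B w : laguerre_pair B w -> exists P, pearson_pair B w P.
Proof.
move=> [alpha [a1 BE ww]]; exists (0, 1, 0, alpha, -1).
have pw : pearson_weight B w 0 1 0 alpha (-1).
  apply: (@pearson_weight_eq _ _ _ (fun x => expR (alpha * ln x + (-1) * x))).
    move=> x xB; rewrite ww //; move: xB; rewrite BE inE /= in_itv /= andbT => x0.
    by rewrite /powR gt_eqF // -expRD mulN1r.
  rewrite BE; exact: laguerre_pearson_weight.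
split=> //; have [a0|a0] := eqVneq alpha 0; [right|left].
  exists 1, 0, (-1); split=> [x dw xB wx|k]; last by rewrite mulr0 addr0 oppr_eq0 oner_eq0.
  have := pearson_weight_derive pw xB wx.
  have x0 : 0 < x by move: xB; rewrite BE /= in_itv /= andbT.
  move=> e; apply: (mulfI (lt0r_neq0 x0)); move: e; rewrite a0 => e.
  transitivity ((0 + 1 * x + 0 * x ^+ 2) * dw); first by ring.
  by rewrite e; ring.
exists 1, [:: 0]; split=> // [t|r].
  by rewrite big_seq1; ring.
by rewrite inE => /eqP ->; rewrite mulr0 addr0.
Qed.

Lemma jacobi_pair_pearson B w : jacobi_pair B w -> exists P, pearson_pair B w P.
Proof.
move=> [alpha [beta [a1 b1 BE ww]]]; exists (1, 0, -1, beta - alpha, - (alpha + beta)).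
have Bin x : B x -> 0 < 1 - x /\ 0 < 1 + x.
  by rewrite BE /= in_itv /= => /andP[x1 x2]; rewrite subr_gt0 -ltrBlDl sub0r.
have pw : pearson_weight B w 1 0 (-1) (beta - alpha) (- (alpha + beta)).
  apply: (@pearson_weight_eq _ _ _ (fun x => expR (alpha * ln (1 - x) + beta * ln (1 + x)))).
    move=> x xB; rewrite ww //; move: xB; rewrite inE => /Bin[x1 x2].
    by rewrite /powR !gt_eqF // -expRD.
  rewrite BE; exact: jacobi_pearson_weight.
split=> //.
have [a0|a0] := eqVneq alpha 0.
  right; exists 1, 1, beta; split=> [x dw xB wx|k]; last first.
    by rewrite gt_eqF // mulr1 -natr1; have := ler0n R k; move: b1; lra.
  have := pearson_weight_derive pw xB wx; have [x1 x2] := Bin x xB.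
  move=> e; apply: (mulfI (lt0r_neq0 x1)); move: e; rewrite a0 => e.
  transitivity ((1 + 0 * x + -1 * x ^+ 2) * dw); first by ring.
  by rewrite e; ring.
have [b0|b0] := eqVneq beta 0.
  right; exists 1, (-1), (- alpha); split=> [x dw xB wx|k]; last first.
    by rewrite lt_eqF // mulrN1 -natr1; have := ler0n R k; move: a1; lra.
  have := pearson_weight_derive pw xB wx; have [x1 x2] := Bin x xB.
  move=> e; apply: (mulfI (lt0r_neq0 x2)); move: e; rewrite b0 => e.
  transitivity ((1 + 0 * x + -1 * x ^+ 2) * dw); first by ring.
  by rewrite e; ring.
left; exists (-1), [:: 1; -1]; split=> [||t|r].
- by rewrite oppr_eq0 oner_eq0.
- have e : 1 - (-1) = 2%:R :> R by ring.
  by rewrite /= inE andbT -subr_eq0 e pnatr_eq0.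
- by rewrite big_cons big_seq1; ring.
- rewrite !inE => /orP[] /eqP ->.
    have -> : beta - alpha + - (alpha + beta) * 1 = - (2 * alpha) by ring.
    by rewrite oppr_eq0 mulf_neq0 // pnatr_eq0.
  have -> : beta - alpha + - (alpha + beta) * -1 = 2 * beta by ring.
  by rewrite mulf_neq0 // pnatr_eq0.
Qed.

End ClassicalPairs.

(** * Product weights *)

Section ProductWeight.
Variables (R : realType) (n : nat).

(** Along the line through x in the direction of the i-th coordinate, w is wi i times a
    constant, at least near x since Bi i is open. *)
Lemma derive_product_weight (Bi : 'I_n -> set R) (wi : 'I_n -> R -> R)
    (w : 'rV[R]_n -> R) (i : 'I_n) (x : 'rV[R]_n) (dw : R) :
  open (Bi i) -> (forall j, Bi j (x ord0 j)) ->
  (forall y : 'rV[R]_n, (forall j, Bi j (y ord0 j)) -> w y = \prod_j wi j (y ord0 j)) ->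
  is_derive (x ord0 i) 1 (wi i) dw ->
  'D_(delta_mx ord0 i) w x = (\prod_(j | j != i) wi j (x ord0 j)) * dw.
Proof.
move=> oBi xB wE dwi; set C := \prod_(j | _) _.
have <- : 'D_1 (fun t => C * wi i t) (x ord0 i) = C * dw.
  have D := is_deriveZ C dwi; exact: (@derive_val _ _ _ _ _ _ _ D).
have coord (h : R) j : (h *: delta_mx ord0 i + x : 'rV[R]_n) ord0 j =
    if j == i then h + x ord0 i else x ord0 j.
  by rewrite !mxE eqxx /=; case: eqP => [->|_]; rewrite ?mulr1 ?mulr0 ?add0r.
have wline (h : R) : Bi i (h + x ord0 i) ->
    w (h *: delta_mx ord0 i + x) = C * wi i (h *: 1 + x ord0 i).
  move=> hB; rewrite wE => [|j]; last by rewrite coord; case: eqP => // ->.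
  rewrite (bigD1 i) //= coord eqxx mulrC [h *: 1]mulr1; congr (_ * _).
  by apply: eq_bigr => j ji; rewrite coord (negbTE ji).
have wx : w x = C * wi i (x ord0 i).
  by rewrite wE // (bigD1 i) //= mulrC.
have near_line : \forall h \near 0^', Bi i (h + x ord0 i).
  have /nbhs_ballP[e e0 eB] : nbhs (x ord0 i) (Bi i) by exact: open_nbhs_nbhs.
  near=> h; apply: eB; rewrite /ball /= opprD addrCA subrr addr0 normrN.
  by near: h; exact: dnbhs0_lt.
rewrite /derive; congr (lim _).
rewrite eqEsubset; split; apply: near_eq_cvg; near=> h => /=; rewrite wline ?wx //;
  by near: h.
Unshelve. all: by end_near. Qed.

End ProductWeight.

Section Moments.
Variables (R : realType) (n : nat).
Local Notation mp := (cpoly R n).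

(** The moments in the variables other than x_i factor out, and what remains is the
    recurrence for those of x_i. *)
Lemma moment_functional_pearson_op (L : mp -> R[i]) (M : 'I_n -> nat -> R) (i : 'I_n)
    (p0 p1 p2 q0 q1 : R) (m : mpoly.multinom n) :
  (forall a u v, L (a *: u + v) = a * L u + L v) ->
  (forall m, L (Xmon m) = (\prod_(j < n) M j (m j))%:C) ->
  (forall k, k%:R * p0 * M i k.-1 + (q0 + k.+1%:R * p1) * M i k +
    (q1 + k.+2%:R * p2) * M i k.+1 = 0) ->
  L (real_pearson_op i p0 p1 p2 q0 q1 (Xmon m)) = 0.
Proof.
move=> L_lin LX rec.
have L0 : L 0 = 0.
  by have := L_lin (-1) 0 0; rewrite scaler0 addr0 mulN1r addNr.
rewrite /real_pearson_op pearson_op_monomial -!addrA !L_lin.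
rewrite -[_ *: Xmon (mpoly.mnm_add _ _)]addr0 L_lin L0 addr0 !LX.
rewrite !(bigD1 (P := xpredT) i) //=.
have other (m' : mpoly.multinom n) : (forall j, j != i -> m' j = m j) ->
    \prod_(j < n | j != i) M j (m' j) = \prod_(j < n | j != i) M j (m j).
  by move=> mm; apply: eq_bigr => j ji; rewrite mm.
rewrite (other (mpoly.mnm_sub _ _)); last first.
  by move=> j ji; rewrite mpoly.mnmBE mpoly.mnm1E eq_sym (negbTE ji) subn0.
rewrite (other (mpoly.mnm_add _ _)); last first.
  by move=> j ji; rewrite mpoly.mnmDE mpoly.mnm1E eq_sym (negbTE ji) addn0.
rewrite mpoly.mnmBE mpoly.mnmDE mpoly.mnm1E eqxx subn1 addn1.
move: (\prod_(j < n | j != i) _) (rec (m i)) => Q e.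
rewrite -!(rmorph_nat (real_complex R)) -!rmorphM -!rmorphD -!rmorphM -!rmorphD /=.
rewrite -[RHS](rmorph0 (real_complex R)) -(mulr0 Q) -e; congr (real_complex R _); ring.
Qed.
End Moments.

Lemma product_weight_mathieu (R : realType) (pair : set R -> (R -> R) -> Prop)
    (n : nat) (B : set 'rV[R]_n) (w : 'rV[R]_n -> R) :
  integral_conjecture R ->
  (forall B1 w1, pair B1 w1 -> exists P, pearson_pair B1 w1 P) ->
  (0 < n)%N -> product_weight pair B w -> mathieu_subspace (ImLambda' B w).
Proof.
move=> conj pairP n0 [Bi [wi [pi BE wE]]].
have [P hP] := choice (fun i => pairP _ _ (pi i)).
pose p0 i := (P i).1.1.1.1; pose p1 i := (P i).1.1.1.2; pose p2 i := (P i).1.1.2.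
pose q0 i := (P i).1.2; pose q1 i := (P i).2.
have pw i : pearson_weight (Bi i) (wi i) (p0 i) (p1 i) (p2 i) (q0 i) (q1 i).
  by have := hP i; rewrite /p0 /p1 /p2 /q0 /q1; case: (P i) => [[[[? ?] ?] ?] ?] [].
have cases i : nondegenerate (p0 i) (p1 i) (p2 i) (q0 i) (q1 i) \/ degenerate (Bi i) (wi i).
  by have := hP i; rewrite /p0 /p1 /p2 /q0 /q1; case: (P i) => [[[[? ?] ?] ?] ?] [].
have logder i x dw : B x -> is_derive (x ord0 i) 1 (wi i) dw ->
    (w x)^-1 * 'D_(delta_mx ord0 i) w x = dw / wi i (x ord0 i).
  rewrite BE => xB dwi.
  have wE' (y : 'rV[R]_n) : (forall j, Bi j (y ord0 j)) -> w y = \prod_j wi j (y ord0 j).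
    by move=> yB; apply: wE; rewrite inE BE.
  rewrite (derive_product_weight (pw_open (pw i)) xB wE' dwi) (wE' _ xB) (bigD1 i) //=.
  have wi0 : wi i (x ord0 i) != 0 by rewrite gt_eqF // (pw_gt0 (pw i)).
  have C0 : \prod_(j | j != i) wi j (x ord0 j) != 0.
    by apply/prodf_neq0 => j _; rewrite gt_eqF // (pw_gt0 (pw j)).
  by field; rewrite wi0 C0.
have [[i [a0 [a1 [b0 [dg lead]]]]]|all_nondeg] :
    (exists i, degenerate (Bi i) (wi i)) \/
    forall i, nondegenerate (p0 i) (p1 i) (p2 i) (q0 i) (q1 i).
  have [?|nex] := pselect (exists i, degenerate (Bi i) (wi i)); [by left|right] => i.
  by case: (cases i) => // dgi; exfalso; apply: nex; exists i.
  have full f : ImLambda' B w f.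
    apply: (@ImLambda_degenerate _ _ _ _ i a0 a1 b0) => // x xB.
    have xBi : Bi i (x ord0 i) by move: xB; rewrite BE; exact.
    have [dw dwi _] := pw_derive (pw i) xBi.
    rewrite (logder _ _ _ xB dwi) mulrA (dg _ _ xBi dwi) mulfK //.
    by rewrite gt_eqF // (pw_gt0 (pw i)).
  split; first exact: ImLambda_submod.
  by move=> f _ g; apply: nearW => m; exact: full.
have [mu mom] := choice (fun i => pw_moments (pw i)).
have {mom} [M mom] := choice mom.
have [sigma sigmaP] := product_measure_moments
  (fun i => let: And4 h _ _ _ := mom i in h) (fun i => let: And4 _ h _ _ := mom i in h).
have [c hc] := choice all_nondeg; have {hc} [rs hrs] := choice hc.
have -> : ImLambda' B w = [set f | cintegral sigma setT (ceval f) = 0].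
  apply: (@ImLambda_kernel R n B w _ p0 p1 p2 q0 q1 _ c rs).
  - by move=> x x01; rewrite BE => i; exact: (pw_unit_itv (pw i)).
  - move=> i x xB; have xBi : Bi i (x ord0 i) by move: xB; rewrite BE; exact.
    have [dw dwi e] := pw_derive (pw i) xBi.
    rewrite (logder _ _ _ xB dwi) mulrA e mulfK //.
    by rewrite gt_eqF // (pw_gt0 (pw i)).
  - by move=> i; case: (hrs i).
  - by move=> i; case: (hrs i).
  - by move=> i; case: (hrs i).
  - by move=> i; case: (hrs i).
  - exact: (cintegral_poly_linear sigmaP).
  - rewrite -(mpoly.mpolyX0 n R[i]) (cintegral_monomial sigmaP) fmorph_eq0.
    by apply/prodf_neq0 => i _; rewrite mpoly.mnm0E; case: (mom i).
  - move=> i m; apply: (@moment_functional_pearson_op R n (fun f => cintegral sigma setT (ceval f)) M).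
    + exact: (cintegral_poly_linear sigmaP).
    + exact: (cintegral_monomial sigmaP).
    + by case: (mom i).
  - by move=> i k; exact: (pw_leading (pw i)).
(* The density vanishes outside B, so the conjecture is used on the whole space. *)
apply: conj => //; first exact: openT.
exact: (cintegrable_poly sigmaP).
Qed.

Theorem corollary4p2 (R : realType) :
  integral_conjecture R -> image_conjecture_classical R.
Proof.
move=> conj n B w n0 [] pw.
- exact: product_weight_mathieu conj (@hermite_pair_pearson R) n0 pw.
- exact: product_weight_mathieu conj (@laguerre_pair_pearson R) n0 pw.
- exact: product_weight_mathieu conj (@jacobi_pair_pearson R) n0 pw.
Qed.
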